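(* Let $u^-\in\mathcal{L}^2([t_0,t_f];\mathbb{R}^m)$. The projection $P_{\mathcal{A}}(u^-)$ of $u^-$ onto the constraint set $\mathcal{A}$, i.e. the solution of the problem of minimizing $\frac12\|u-u^-\|_{\mathcal{L}^2}^2$ subject to $u\in\mathcal{A}$, is given by $$P_{\mathcal{A}}(u^-)(t)=u^-(t)-B(t)^T\,\Phi_A(t_0,t)^T\,\overline{\lambda}$$ for all $t\in[t_0,t_f]$, where $\overline{\lambda}\in\mathbb{R}^n$ solves $$\frac{\partial y(t_f)}{\partial\lambda_0}\,\overline{\lambda}=-(y(t_f)-x_f),$$ with $$y(t_f):=\Phi_A(t_f,t_0)\,x_0+\int_{t_0}^{t_f}\Phi_A(t_f,\tau)\,B(\tau)\,u^-(\tau)\,d\tau .$$ Moreover, $\dfrac{\partial y(t_f)}{\partial\lambda_0}=J_\varphi(0)$, where $\varphi$ is the near-miss function.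
   Context: Let $t_0<t_f$, $x_0,x_f\in\mathbb{R}^n$, and let $A:[t_0,t_f]\to\mathbb{R}^{n\times n}$, $B:[t_0,t_f]\to\mathbb{R}^{n\times m}$ be continuous. $\mathcal{L}^2([t_0,t_f];\mathbb{R}^q)$ is the Hilbert space of square-integrable functions with norm $\|z\|_{\mathcal{L}^2}=(\int_{t_0}^{t_f}\|z(t)\|^2dt)^{1/2}$ (functions identified when equal almost everywhere), and $\mathcal{W}^{1,2}([t_0,t_f];\mathbb{R}^q)$ is the space of absolutely continuous $z\in\mathcal{L}^2$ with $\dot z\in\mathcal{L}^2$. The constraint set is $$\mathcal{A}:=\{u\in\mathcal{L}^2([t_0,t_f];\mathbb{R}^m)\,:\,\exists x\in\mathcal{W}^{1,2}([t_0,t_f];\mathbb{R}^n)\text{ with }\dot x(t)=A(t)x(t)+B(t)u(t),\ x(t_0)=x_0,\ x(t_f)=x_f\}.$$ Standing assumption: the system $\dot x=A(t)x+B(t)u$ is controllable on $[t_0,t_f]$, i.e. for any initial state and any terminal state in $\mathbb{R}^n$ there is an (unconstrained) control $u$ driving the system from the initial state at $t_0$ to the terminal state at $t_f$. $\Phi_A(t,s)$ denotes the state transition matrix of $\dot x(t)=A(t)x(t)$: the unique matrix with $x(t)=\Phi_A(t,s)x(s)$ for all solutions $x$. For $\lambda_0\in\mathbb{R}^n$ let $z(\cdot,\lambda_0)$ be the solution of $$\frac{\partial z(t,\lambda_0)}{\partial t}=A(t)z(t,\lambda_0)+B(t)\left[u^-(t)-B(t)^T\Phi_A(t_0,t)^T\lambda_0\right],\qquad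 z(t_0,\lambda_0)=x_0 .$$ The near-miss function is $\varphi(\lambda_0):=z(t_f,\lambda_0)-x_f$; it is affine, and $J_\varphi(0)$ denotes its (constant, $n\times n$) Jacobian. One writes $y(\cdot):=z(\cdot,0)$, and $\partial y(t_f)/\partial\lambda_0$ denotes the Jacobian $\partial z(t_f,0)/\partial\lambda_0$ of $\lambda_0\mapsto z(t_f,\lambda_0)$ evaluated at $\lambda_0=0$. *)

(* Defs.v *)
From HB Require Import structures.
From mathcomp Require Import all_boot all_order all_algebra.
From mathcomp Require Import all_classical all_reals all_analysis.

Set Implicit Arguments.
Unset Strict Implicit.
Unset Printing Implicit Defensive.
Import Order.TTheory GRing.Theory Num.Theory.
Import numFieldNormedType.Exports.

Local Open Scope classical_set_scope.
Local Open Scope ring_scope.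

(* Vectors of R^q are columns.  Functions on [t0, tf] are total functions on R
   of which only the values on [t0, tf] are ever constrained or used. *)

Section FunctionSpaces.
Context {R : realType}.

(* The norm of 'cV[R]_q provided by the library is the sup norm; the L2 norm is
   built on the Euclidean one. *)
Definition enorm {q : nat} (v : 'cV[R]_q) : R :=
  Num.sqrt (\sum_(i < q) v i 0 ^+ 2).

(* An element of L2 is given by a Borel representative; every class of
   Lebesgue-measurable functions modulo a.e. equality has one. *)
Definition L2 {q : nat} (t0 tf : R) (z : R -> 'cV[R]_q) : Prop :=
  (forall i : 'I_q, measurable_fun `[t0, tf] (fun t => z t i 0)) /\
  (\int[lebesgue_measure]_(t in `[t0, tf]) (enorm (z t) ^+ 2)%:E < +oo)%E.

Definition L2norm {q : nat} (t0 tf : R) (z : R -> 'cV[R]_q) : R :=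
  Num.sqrt (\int[lebesgue_measure]_(t in `[t0, tf]) (enorm (z t) ^+ 2)).

(* Each (a i, b i) is an open subinterval of [t0, tf], and they are pairwise
   disjoint.  All norms on R^q being equivalent, the sup norm is used. *)
Definition absolutely_continuous {q : nat} (t0 tf : R) (z : R -> 'cV[R]_q) : Prop :=
  forall e : R, 0 < e -> exists2 d : R, 0 < d &
    forall (k : nat) (a b : 'I_k -> R),
      (forall i, t0 <= a i /\ a i <= b i /\ b i <= tf) ->
      (forall i j, i != j -> b i <= a j \/ b j <= a i) ->
      \sum_(i < k) (b i - a i) < d ->
      \sum_(i < k) `|z (b i) - z (a i)| < e.

Definition ae_derivative {q : nat} (t0 tf : R) (z dz : R -> 'cV[R]_q) : Prop :=
  {ae lebesgue_measure, forall t : R,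
    `[t0, tf]%classic t -> is_derive t 1 z (dz t)}.

Definition W12 {q : nat} (t0 tf : R) (z : R -> 'cV[R]_q) : Prop :=
  [/\ absolutely_continuous t0 tf z, L2 t0 tf z &
      exists2 dz : R -> 'cV[R]_q, L2 t0 tf dz & ae_derivative t0 tf z dz].

Definition vint {q : nat} (t0 tf : R) (f : R -> 'cV[R]_q) : 'cV[R]_q :=
  \col_(i < q) \int[lebesgue_measure]_(t in `[t0, tf]) f t i 0.

(* The library's Jacobian acts on row vectors from the right; this is its
   transpose, with entry (i, j) the j-th partial derivative of f_i. *)
Definition cjacobian {p q : nat} (f : 'cV[R]_p -> 'cV[R]_q) (a : 'cV[R]_p) :
    'M[R]_(q, p) :=
  ('J (fun v : 'rV[R]_p => (f v^T)^T) a^T)^T.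

(* p is the unique (modulo a.e. equality) solution of
   "minimize 1/2 ||u - w||^2 subject to u in C". *)
Definition is_projection {q : nat} (t0 tf : R) (C : set (R -> 'cV[R]_q))
    (w p : R -> 'cV[R]_q) : Prop :=
  let cost u := 2^-1 * L2norm t0 tf (fun t => u t - w t) ^+ 2 in
  let solution v := C v /\ forall u, C u -> cost v <= cost u in
  solution p /\
  forall v, solution v ->
    {ae lebesgue_measure, forall t : R, `[t0, tf]%classic t -> v t = p t}.

End FunctionSpaces.

Section ControlSystem.
Context {R : realType} {n m : nat}.

Definition solves_ode (t0 tf : R) (A : R -> 'M[R]_n) (f x : R -> 'cV[R]_n) : Prop :=
  W12 t0 tf x /\ ae_derivative t0 tf x (fun t => A t *m x t + f t).

Definition constraint_set (t0 tf : R) (A : R -> 'M[R]_n)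
    (B : R -> 'M[R]_(n, m)) (x0 xf : 'cV[R]_n) : set (R -> 'cV[R]_m) :=
  [set u | L2 t0 tf u /\
    exists x : R -> 'cV[R]_n,
      [/\ solves_ode t0 tf A (fun t => B t *m u t) x, x t0 = x0 & x tf = xf]].

Definition controllable (t0 tf : R) (A : R -> 'M[R]_n)
    (B : R -> 'M[R]_(n, m)) : Prop :=
  forall xi xe : 'cV[R]_n, constraint_set t0 tf A B xi xe !=set0.

(* xget selects the matrix, which is unique for s, t in [t0, tf]. *)
Definition transition_matrix (t0 tf : R) (A : R -> 'M[R]_n) (t s : R) : 'M[R]_n :=
  xget 0 [set P : 'M[R]_n |
    forall x : R -> 'cV[R]_n,
      solves_ode t0 tf A (fun=> 0) x -> x t = P *m x s].

Definition shifted_control (t0 tf : R) (A : R -> 'M[R]_n)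
    (B : R -> 'M[R]_(n, m)) (um : R -> 'cV[R]_m) (lam : 'cV[R]_n) :
    R -> 'cV[R]_m :=
  fun t => um t - (B t)^T *m (transition_matrix t0 tf A t0 t)^T *m lam.

(* xget selects the solution, whose restriction to [t0, tf] is unique. *)
Definition zsol (t0 tf : R) (A : R -> 'M[R]_n)
    (B : R -> 'M[R]_(n, m)) (x0 : 'cV[R]_n) (um : R -> 'cV[R]_m)
    (lam : 'cV[R]_n) : R -> 'cV[R]_n :=
  xget (fun=> 0) [set z : R -> 'cV[R]_n |
    solves_ode t0 tf A
      (fun t => B t *m shifted_control t0 tf A B um lam t) z /\ z t0 = x0].

Definition near_miss (t0 tf : R) (A : R -> 'M[R]_n)
    (B : R -> 'M[R]_(n, m)) (x0 xf : 'cV[R]_n) (um : R -> 'cV[R]_m)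
    (lam : 'cV[R]_n) : 'cV[R]_n :=
  zsol t0 tf A B x0 um lam tf - xf.

End ControlSystem.

(* Main.v *)
Require Import Defs.
From HB Require Import structures.
From mathcomp Require Import all_boot all_order all_algebra.
From mathcomp Require Import all_classical all_reals all_analysis.
From mathcomp Require Import measurable_realfun.
From mathcomp Require Import ring lra.
Import Order.TTheory GRing.Theory Num.Theory.
Import numFieldNormedType.Exports.
Local Open Scope classical_set_scope.
Local Open Scope ring_scope.

(** On [t0, tf] let X be the fundamental matrix of x' = A x with X(t0) = 1, and
    Y its pointwise inverse, which solves the adjoint equation Y' = - Y A.  For a
    square-integrable forcing term f, the absolutely continuous solutions of
    x' = A x + f are exactly x(t) = X(t) (x(t0) + int_t0^t Y f): the product Y x
    is absolutely continuous with derivative Y f almost everywhere, and an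
    absolutely continuous function is determined by its initial value and its
    almost everywhere derivative ([ac_derive0_eq], [solves_response],
    [response_solves]).  Consequently Phi_A(t, s) = X(t) Y(s)
    ([transition_matrixE]), and a control u steers x0 to xf iff
    X(tf) (x0 + E u) = xf, where E u = int Y B u ([constraint_setE]).

    Put K = Y B.  The adjoint of E for the L2 inner product sends lambda to
    G lambda = K^T lambda = B^T Phi_A(t0, .)^T lambda, and E G is the Gramian
    W = int K K^T.  Hence the final state reached with the control
    u^- - G lambda is y(tf) - X(tf) W lambda ([zsol_final]), an affine function
    of lambda whose Jacobian is - X(tf) W.  Controllability makes W invertible
    ([gramian_unit]): if W v = 0 then |G v|^2 = v^T W v = 0, whereas a control u
    with E u = v gives |v|^2 = <u, G v> = 0.  So the linear equation for lambda
    has a solution.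

    For such a lambda the control p = u^- - G lambda is admissible.  If u is
    admissible as well, then E (u - p) = 0, so u - p is orthogonal to
    p - u^- = - G lambda, and Pythagoras gives
    |u - u^-|^2 = |p - u^-|^2 + |u - p|^2 ([cost_pythagoras]); this is both the
    minimality of p and its uniqueness up to a null set.

    The analytic input consists of two facts.  An absolutely continuous
    function whose derivative vanishes almost everywhere is constant: the
    exceptional set is covered by an open set G of small measure, and an
    induction along the segment bounds the total increment by a small slope plus
    the increments over disjoint intervals whose total length is at most the
    measure of G.  The fundamental matrix exists by Picard iteration, which
    converges geometrically once the increments are compared with the weight
    exp (L (t - t0)) for L large ([linear_ode_exists]). *)

Set Implicit Arguments.
Unset Strict Implicit.
Unset Printing Implicit Defensive.

(** * Absolutely continuous functions with derivative zero almost everywhere *)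

Section ScalarAC.
Context {R : realType}.
Implicit Types f g : R -> R.

(** The intervals ]a i, b i[, i < k, are pairwise disjoint and contained in
    [t0, tf]; degenerate intervals are allowed. *)
Definition disjoint_intervals (t0 tf : R) (k : nat) (a b : 'I_k -> R) : Prop :=
  (forall i, t0 <= a i /\ a i <= b i /\ b i <= tf) /\
  (forall i j, i != j -> b i <= a j \/ b j <= a i).

(** Absolute continuity on [t0, tf] of a real-valued function. *)
Definition acfun (t0 tf : R) f : Prop :=
  forall e : R, 0 < e -> exists2 d : R, 0 < d &
    forall (k : nat) (a b : 'I_k -> R), disjoint_intervals t0 tf a b ->
      \sum_(i < k) (b i - a i) < d ->
      \sum_(i < k) `|f (b i) - f (a i)| < e.

Lemma acfunS (t0 tf s u : R) f : t0 <= s -> u <= tf -> acfun t0 tf f -> acfun s u f.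
Proof.
move=> t0s utf acf e /acf[d d0 Hd]; exists d => // k a b [ab dab]; apply: Hd.
split=> // i; have [sa [aib bu]] := ab i.
by rewrite (le_trans t0s sa) (le_trans bu utf).
Qed.

Definition cat_ord {T : Type} {k l : nat} (a : 'I_k -> T) (b : 'I_l -> T) :
    'I_(k + l) -> T :=
  fun i => match fintype.split i with inl j => a j | inr j => b j end.

Lemma big_cat_ord {T : Type} {k l : nat} (F : T -> T -> R)
    (a b : 'I_k -> T) (c d : 'I_l -> T) :
  \sum_(i < k + l) F (cat_ord a c i) (cat_ord b d i) =
  \sum_(i < k) F (a i) (b i) + \sum_(i < l) F (c i) (d i).
Proof.
rewrite big_split_ord; congr (_ + _); apply: eq_bigr => i _; rewrite /cat_ord.
  by rewrite (unsplitK (inl i)).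
by rewrite (unsplitK (inr i)).
Qed.

Lemma disjoint_intervals_cat s t u (k l : nat) (a b : 'I_k -> R) (c d : 'I_l -> R) :
  s <= t -> t <= u -> disjoint_intervals s t a b -> disjoint_intervals t u c d ->
  disjoint_intervals s u (cat_ord a c) (cat_ord b d).
Proof.
move=> st tu [ab dab] [cd dcd]; split=> [i|i j].
  rewrite /cat_ord; case: (fintype.split i) => j.
    by have [? [? ?]] := ab j; split=> //; split=> //; apply: le_trans tu.
  by have [? [? ?]] := cd j; split=> //; exact: le_trans st _.
rewrite /cat_ord -{1}(splitK i) -{1}(splitK j).
case: (fintype.split i) => i'; case: (fintype.split j) => j' ij.
- by apply: dab; apply: contra ij => /eqP ->; rewrite eqxx.
- left; have [_ [_ bt]] := ab i'; have [tc _] := cd j'; exact: le_trans bt tc.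
- right; have [_ [_ bt]] := ab j'; have [tc _] := cd i'; exact: le_trans bt tc.
- by apply: dcd; apply: contra ij => /eqP ->; rewrite eqxx.
Qed.

(** Up to a slope e, the increment of f over [s, t] is controlled by its
    increments over finitely many disjoint subintervals whose total length is at
    most the measure of G in [s, t[.  Stated with the half-open interval, the
    measure bound is additive under concatenation. *)
Definition almost_const (G : set R) (e : R) f (s t : R) : Prop :=
  exists (k : nat) (a b : 'I_k -> R), [/\ disjoint_intervals s t a b,
    ((\sum_(i < k) (b i - a i))%:E <= lebesgue_measure (G `&` `[s, t[%classic))%E &
    `|f t - f s| <= e * (t - s) + \sum_(i < k) `|f (b i) - f (a i)|].

Lemma almost_const_trans (G : set R) e f s t u : open G -> s <= t -> t <= u ->
  almost_const G e f s t -> almost_const G e f t u -> almost_const G e f s u.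
Proof.
move=> oG st tu [k [a [b [sab mab fab]]]] [l [c [d [scd mcd fcd]]]].
exists (k + l)%N, (cat_ord a c), (cat_ord b d); split.
- exact: disjoint_intervals_cat sab scd.
- rewrite (big_cat_ord (fun x y => y - x)).
  rewrite (@itv_bndbnd_setU _ _ (BLeft s) (BLeft t) (BLeft u))//.
  rewrite setIUr measureU ?EFinD ?leeD//.
  + by apply: measurableI => //; exact: open_measurable.
  + by apply: measurableI => //; exact: open_measurable.
  + rewrite -subset0 => x [[_ xst] [_ xtu]].
    have : x \in `[s, t[%R by exact: xst.
    have : x \in `[t, u[%R by exact: xtu.
    rewrite !in_itv/= => /andP[tx _] /andP[_ xt].
    by move: (lt_le_trans xt tx); rewrite ltxx.
- rewrite (big_cat_ord (fun x y => `|f y - f x|)).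
  have -> : f u - f s = (f u - f t) + (f t - f s) by lra.
  apply: le_trans (ler_normD _ _) _.
  have -> : e * (u - s) = e * (u - t) + e * (t - s) by ring.
  lra.
Qed.

Lemma almost_const_open (G : set R) e f s t : 0 <= e -> s <= t ->
  `[s, t[%classic `<=` G -> almost_const G e f s t.
Proof.
move=> e0 st sG; exists 1%N, (fun=> s), (fun=> t); split.
- by split=> // i j; rewrite !ord1 eqxx.
- rewrite big_ord1 setIC setIidl// lebesgue_measure_itv/= lte_fin.
  by case: ltP => // ts; rewrite lee_fin subr_le0.
- by rewrite big_ord1 lerDr mulr_ge0// subr_ge0.
Qed.

Lemma almost_const_slope (G : set R) e f s t : s <= t ->
  `|f t - f s| <= e * (t - s) -> almost_const G e f s t.
Proof.
move=> st sG; exists 0%N, (fun=> s), (fun=> t); split.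
- by split=> -[].
- by rewrite big_ord0.
- by rewrite big_ord0 addr0.
Qed.

Lemma is_derive0_slope f (x e : R) : 0 < e -> is_derive x 1 f 0 ->
  exists2 d, 0 < d & forall y, `|y - x| < d -> `|f y - f x| <= e * `|y - x|.
Proof.
move=> e0 [dfx fx0].
have : (h^-1 *: (f (h *: 1 + x) - f x)) @[h --> 0^'] --> 'D_1 f x.
  exact: dfx.
rewrite fx0 => /cvgrPdist_le/(_ _ e0)[/= d d0 dP]; exists d => // y yxd.
have [->|yx] := eqVneq y x; first by rewrite !subrr normr0 mulr0.
have yx0 : y - x != 0 by rewrite subr_eq0.
have := dP (y - x); rewrite /ball_/= sub0r normrN => /(_ yxd yx0).
rewrite sub0r normrN [_ *: 1]mulr1 subrK normrM normfV.
by rewrite mulrC ler_pdivrMr ?normr_gt0.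
Qed.

(** Cousin-style induction along a segment: a relation that can be concatenated
    and that holds on both sides of every point, locally, holds between the
    endpoints. *)
Lemma segment_induction (P : R -> R -> Prop) (t0 tf : R) : t0 <= tf ->
  (forall s t u, s <= t -> t <= u -> P s t -> P t u -> P s u) ->
  (forall x, t0 <= x <= tf -> exists2 d, 0 < d & forall s t, t0 <= s -> t <= tf ->
     s <= x -> x <= t -> x - s < d -> t - x < d -> P s x /\ P x t) ->
  P t0 tf.
Proof.
move=> t0tf Ptr Ploc.
pose S := [set s | t0 <= s <= tf /\ P t0 s].
have St0 : S t0.
  split; first by rewrite lexx.
  have [|d d0 dP] := Ploc t0; first by rewrite lexx.
  by have [] := dP t0 t0; rewrite ?subrr.
have Sub : ubound S tf by move=> s [/andP[]].
have hS : has_sup S := conj (ex_intro _ t0 St0) (ex_intro _ tf Sub).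
have cP : t0 <= sup S <= tf.
  apply/andP; split; last by apply: sup_le_ub => //; exists t0.
  by apply: ub_le_sup => //; exists tf.
have [d d0 dP] := Ploc _ cP; case/andP: cP => t0c ctf.
have [s [/andP[t0s stf] Ps] cs] := sup_adherent d0 hS.
have sc : s <= sup S by apply: ub_le_sup; [exists tf|split => //; rewrite t0s].
have [Psc _] : P s (sup S) /\ P (sup S) (sup S).
  by apply: dP => //; rewrite ?subrr//; lra.
have Pc : P t0 (sup S) by exact: Ptr Psc.
pose u := Num.min tf (sup S + d / 2).
have cu : sup S <= u by rewrite /u le_min ctf/= lerDl; lra.
have utf : u <= tf by rewrite /u ge_min lexx.
have uc : u <= sup S + d / 2 by rewrite /u ge_min lexx orbT.
have ud : u - sup S < d by lra.
have [_ Pcu] : P (sup S) (sup S) /\ P (sup S) u.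
  by apply: dP => //; rewrite subrr.
have Su : S u by split; [rewrite utf (le_trans t0c)|exact: Ptr Pcu].
have : u <= sup S by apply: ub_le_sup => //; exists tf.
rewrite /u ge_min => /orP[tfc|]; last by lra.
by have -> : tf = sup S by apply/eqP; rewrite eq_le tfc.
Qed.

Lemma ac_derive0_eq (t0 tf : R) f : t0 <= tf -> acfun t0 tf f ->
  {ae lebesgue_measure, forall t, `[t0, tf]%classic t -> is_derive t 1 f 0} ->
  f tf = f t0.
Proof.
move=> t0tf acf [N [mN N0 sN]].
suff H e : 0 < e -> `|f tf - f t0| <= e * (tf - t0) + e.
  apply/eqP; rewrite -subr_eq0 -normr_le0; apply/ler_addgt0Pl => e e0.
  rewrite addr0; have l0 : 0 < tf - t0 + 1 by lra.
  have /H : 0 < e / (tf - t0 + 1) by rewrite divr_gt0.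
  by move/le_trans; apply; rewrite -[X in _ + X]mulr1 -mulrDr divfK// gt_eqF.
move=> e0.
(* U covers the exceptional null set and is too small for f to vary by more
   than e on disjoint intervals of total length at most the measure of U *)
have [d d0 dP] := acf _ e0.
have [|U [oU NU mU]] := lebesgue_regularity_outer mN _ d0.
  by rewrite [X in (X < _)%E]N0.
have mUd : (lebesgue_measure U < d%:E)%E.
  have -> : U = (U `\` N) `|` N by rewrite setUC setDUK.
  apply: le_lt_trans (measureU2 _ _ _) _ => //.
    by apply: measurableD => //; exact: open_measurable.
  by rewrite [X in (_ + X < _)%E]N0 adde0.
suff [k [a [b [sab mab fab]]]] : almost_const U e f t0 tf.
  apply: le_trans fab _; rewrite lerD2l; apply/ltW/dP => //.
  rewrite -lte_fin; apply: le_lt_trans mab _; apply: le_lt_trans mUd.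
  apply: le_measure; rewrite ?inE//.
    by apply: measurableI => //; exact: open_measurable.
  exact: open_measurable.
apply: segment_induction => //.
  by move=> s t u st tu; exact: almost_const_trans.
move=> x /andP[t0x xtf]; have [Ux|nUx] := pselect (U x).
  have /nbhs_ballP[d' /= d'0 d'U] : nbhs x U by exact/open_nbhs_nbhs.
  exists d' => // s t t0s ttf sx xt xs tx.
  split; apply: almost_const_open (ltW e0) _ _ => // y /=;
    rewrite in_itv/= => /andP[ly yu]; apply: d'U; rewrite /ball/= ltr_norml; lra.
have [d' d'0 d'P] : exists2 d, 0 < d &
    forall y, `|y - x| < d -> `|f y - f x| <= e * `|y - x|.
  apply: is_derive0_slope => //.
  apply: contrapT => nd; apply/nUx/NU/sN => /= h; apply/nd/h.
  by rewrite in_itv/= t0x.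
exists d' => // s t t0s ttf sx xt xs tx; split; apply: almost_const_slope => //.
- have := d'P s; rewrite (distrC s) ger0_norm ?subr_ge0// => /(_ xs).
  by rewrite distrC.
- by have := d'P t; rewrite ger0_norm ?subr_ge0// => /(_ tx).
Qed.

End ScalarAC.

(** * Calculus of almost everywhere derivatives *)

Section ACCalculus.
Context {R : realType} (t0 tf : R).
Implicit Types f g h : R -> R.
Notation mu := (@lebesgue_measure R).
Notation D := `[t0, tf]%classic.

Lemma aeS (P Q : R -> Prop) : (forall t, P t -> Q t) ->
  {ae mu, forall t, P t} -> {ae mu, forall t, Q t}.
Proof. by apply: filterS; exact: (ae_filter_ringOfSetsType mu). Qed.

Lemma aeS2 (P Q S : R -> Prop) : (forall t, P t -> Q t -> S t) ->
  {ae mu, forall t, P t} -> {ae mu, forall t, Q t} -> {ae mu, forall t, S t}.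
Proof. by apply: filterS2; exact: (ae_filter_ringOfSetsType mu). Qed.

Lemma acfun_continuous f : acfun t0 tf f -> {within D, continuous f}.
Proof.
move=> acf; apply/subspace_continuousP => x Dx.
apply/cvgrPdist_lt => e e0; have [d d0 dP] := acf _ e0.
near=> y; have Dy : D y by near: y; exact: withinT.
have xyd : `|x - y| < d by near: y; apply: cvg_within; exact: nbhsx_ballx.
move: Dx Dy; rewrite /= !in_itv/= => /andP[t0x xtf] /andP[t0y ytf].
have [xy|/ltW yx] := leP x y.
- have := dP 1%N (fun=> x) (fun=> y); rewrite !big_ord1 distrC; apply.
    by split=> // i j; rewrite !ord1 eqxx.
  by move: xyd; rewrite distrC ger0_norm// subr_ge0.
- have := dP 1%N (fun=> y) (fun=> x); rewrite !big_ord1; apply.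
    by split=> // i j; rewrite !ord1 eqxx.
  by move: xyd; rewrite ger0_norm// subr_ge0.
Unshelve. all: by end_near. Qed.

(** Bounded measurable functions on the segment. *)
Definition bmfun f : Prop :=
  measurable_fun D f /\ exists M : R, forall t, D t -> `|f t| <= M.

Lemma continuous_bmfun f : {within D, continuous f} -> bmfun f.
Proof.
move=> cf; split.
  by apply: subspace_continuous_measurable_fun => //; exact: measurable_itv.
have /compact_bounded[M [Mr MP]] : compact (f @` D).
  by apply: continuous_compact => //; exact: segment_compact.
exists (M + 1) => t Dt; apply: (MP (M + 1)); first by rewrite ltrDl.
by exists t.
Qed.

Lemma acfun_bmfun f : acfun t0 tf f -> bmfun f.
Proof. by move/acfun_continuous/continuous_bmfun. Qed.

Lemma bmfun_cst (c : R) : bmfun (fun=> c).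
Proof. by split; [exact: measurable_cst|exists `|c|]. Qed.

Lemma bmfunD f g : bmfun f -> bmfun g -> bmfun (fun t => f t + g t).
Proof.
move=> [mf [M fM]] [mg [N gN]]; split; first exact: measurable_funD.
exists (M + N) => t Dt; apply: le_trans (ler_normD _ _) _.
by rewrite lerD ?fM ?gN.
Qed.

Lemma bmfunM f g : bmfun f -> bmfun g -> bmfun (fun t => f t * g t).
Proof.
move=> [mf [M fM]] [mg [N gN]]; split; first exact: measurable_funM.
by exists (M * N) => t Dt; rewrite normrM ler_pM ?fM ?gN.
Qed.

Lemma bmfunN f : bmfun f -> bmfun (fun t => - f t).
Proof.
move=> /(bmfunM (bmfun_cst (-1))).
by under eq_fun do rewrite mulN1r.
Qed.

Lemma bmfun_sum (I : Type) (r : seq I) (F : I -> R -> R) :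
  (forall i, bmfun (F i)) -> bmfun (fun t => \sum_(i <- r) F i t).
Proof.
move=> bF; elim: r => [|i r IH].
  by under eq_fun do rewrite big_nil; exact: bmfun_cst.
by under eq_fun do rewrite big_cons; exact: bmfunD.
Qed.

Lemma bmfun_integrable f : bmfun f -> mu.-integrable D (EFin \o f).
Proof.
move=> [mf [M fM]]; apply: measurable_bounded_integrable => //.
- rewrite /= lebesgue_measure_itv/= lte_fin.
  by case: ifPn => _; rewrite -?EFinD ltry.
- exists M; split; first exact: num_real.
  by move=> y My t Dt; apply: le_trans (fM _ Dt) (ltW My).
Qed.

Lemma acfun_cst (c : R) : acfun t0 tf (fun=> c).
Proof.
by move=> e e0; exists 1 => // k a b _ _; rewrite big1// => i _; rewrite subrr normr0.
Qed.

Lemma acfunD f g : acfun t0 tf f -> acfun t0 tf g ->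
  acfun t0 tf (fun t => f t + g t).
Proof.
move=> acf acg e e0; have e20 : 0 < e / 2 by lra.
have [d d0 dP] := acf _ e20; have [c c0 cP] := acg _ e20.
exists (Num.min d c); first by rewrite lt_min d0.
move=> k a b sab; rewrite lt_min => /andP[/(dP _ _ _ sab) fe /(cP _ _ _ sab) ge].
apply: (@le_lt_trans _ _ (\sum_(i < k) (`|f (b i) - f (a i)| + `|g (b i) - g (a i)|))).
  by apply: ler_sum => i _; rewrite opprD addrACA ler_normD.
by rewrite big_split/=; lra.
Qed.

Lemma acfunM f g : acfun t0 tf f -> acfun t0 tf g ->
  acfun t0 tf (fun t => f t * g t).
Proof.
move=> acf acg e e0.
have [_ [M0 fM0]] := acfun_bmfun acf; have [_ [N0 gN0]] := acfun_bmfun acg.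
pose M := Num.max 0 (Num.max M0 N0).
have M_ge0 : 0 <= M by rewrite /M le_max lexx.
have fM t : D t -> `|f t| <= M.
  by move=> /fM0 h; rewrite /M !le_max h orbT.
have gM t : D t -> `|g t| <= M.
  by move=> /gN0 h; rewrite /M !le_max h !orbT.
have e20 : 0 < e / (2 * (M + 1)) by rewrite divr_gt0//; lra.
have [d d0 dP] := acf _ e20; have [c c0 cP] := acg _ e20.
exists (Num.min d c); first by rewrite lt_min d0.
move=> k a b sab; rewrite lt_min => /andP[/(dP _ _ _ sab) fe /(cP _ _ _ sab) ge].
set Sf := \sum_(i < k) _ in fe; set Sg := \sum_(i < k) _ in ge.
apply: (@le_lt_trans _ _ (M * Sf + M * Sg)).
  rewrite !mulr_sumr -big_split/=; apply: ler_sum => i _.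
  have -> : f (b i) * g (b i) - f (a i) * g (a i) =
    (f (b i) - f (a i)) * g (b i) + f (a i) * (g (b i) - g (a i)) by ring.
  apply: le_trans (ler_normD _ _) _; rewrite !normrM (mulrC `|f (b i) - _|).
  have [sabi _] := sab; have [t0a [ab btf]] := sabi i.
  by rewrite lerD// ler_wpM2r// (fM, gM)//= in_itv/=; apply/andP; split; lra.
have h : 0 < M + 1 by lra.
move: fe ge; rewrite !ltr_pdivlMr ?mulr_gt0// => fe ge.
have : 0 <= Sf by apply: sumr_ge0.
have : 0 <= Sg by apply: sumr_ge0.
nra.
Qed.

(** f is absolutely continuous on [t0, tf], with two-sided derivative g at
    almost every point of it. *)
Definition ac_deriv f g : Prop := acfun t0 tf f /\
  {ae mu, forall t, D t -> is_derive t 1 f (g t)}.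

Lemma ac_deriv_eq f g h : (forall t, D t -> g t = h t) ->
  ac_deriv f g -> ac_deriv f h.
Proof.
move=> gh [acf fg]; split=> //.
apply: aeS fg => t fgt Dt; rewrite -gh//; exact: fgt.
Qed.

Lemma ac_deriv_cst (c : R) : ac_deriv (fun=> c) (fun=> 0).
Proof. by split; [exact: acfun_cst|apply: aeW => t _; exact: is_derive_cst]. Qed.

Lemma ac_derivD f g f' g' : ac_deriv f f' -> ac_deriv g g' ->
  ac_deriv (fun t => f t + g t) (fun t => f' t + g' t).
Proof.
move=> [acf df] [acg dg]; split; first exact: acfunD.
by apply: aeS2 df dg => t df dg Dt; apply: is_deriveD; [exact: df|exact: dg].
Qed.

Lemma ac_derivM f g f' g' : ac_deriv f f' -> ac_deriv g g' ->
  ac_deriv (fun t => f t * g t) (fun t => f' t * g t + f t * g' t).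
Proof.
move=> [acf df] [acg dg]; split; first exact: acfunM.
apply: aeS2 df dg => t df dg Dt; apply: is_derive_eq.
  by apply: is_deriveM; [exact: df|exact: dg].
by rewrite /GRing.scale/= addrC (mulrC (g t)).
Qed.

Lemma ac_derivN f f' : ac_deriv f f' -> ac_deriv (fun t => - f t) (fun t => - f' t).
Proof.
move=> df; have := ac_derivM (ac_deriv_cst (-1)) df.
under eq_fun do rewrite mulN1r.
by under [X in ac_deriv _ X]eq_fun do rewrite mulN1r mul0r add0r.
Qed.

Lemma ac_deriv_sum (I : Type) (r : seq I) (F F' : I -> R -> R) :
  (forall i, ac_deriv (F i) (F' i)) ->
  ac_deriv (fun t => \sum_(i <- r) F i t) (fun t => \sum_(i <- r) F' i t).
Proof.
move=> dF; elim: r => [|i r IH].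
  under eq_fun do rewrite big_nil.
  by under [X in ac_deriv _ X]eq_fun do rewrite big_nil; exact: ac_deriv_cst.
under eq_fun do rewrite big_cons.
by under [X in ac_deriv _ X]eq_fun do rewrite big_cons; exact: ac_derivD.
Qed.

(** Restricting to [t0, t] reduces constancy to equality at the endpoints. *)
Lemma ac_deriv_cst_eq f g t : ac_deriv f g -> (forall s, D s -> g s = 0) ->
  D t -> f t = f t0.
Proof.
move=> dfg g0; have [acf] := ac_deriv_eq (h := fun=> 0) g0 dfg.
rewrite /= in_itv/= => df /andP[t0t ttf].
apply: ac_derive0_eq => //; first exact: acfunS acf.
apply: aeS df => s + Ds; apply.
by move: Ds; rewrite /= !in_itv/= => /andP[-> /le_trans ->].
Qed.

Lemma ac_deriv_unique f g h t : ac_deriv f h -> ac_deriv g h -> f t0 = g t0 ->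
  D t -> f t = g t.
Proof.
move=> fh gh fg0 Dt; have := ac_deriv_cst_eq (ac_derivD fh (ac_derivN gh)) _ Dt.
rewrite fg0 subrr => H; apply/eqP; rewrite -subr_eq0; apply/eqP/H => s _.
by rewrite subrr.
Qed.

End ACCalculus.

Section Primitive.
Context {R : realType} (t0 tf : R).
Implicit Types f g h : R -> R.
Notation mu := (@lebesgue_measure R).
Notation D := `[t0, tf]%classic.

(** Indefinite integral from the left end of the segment; the integrand is
    cut off outside the segment so that it is integrable on the whole line. *)
Definition primitive g (t : R) : R := \int[mu]_(s in `[t0, t]) (g \_ D) s.

Lemma primitiveE g t : D t -> primitive g t = \int[mu]_(s in `[t0, t]) g s.
Proof.
rewrite /= in_itv/= => /andP[t0t ttf]; apply: eq_Rintegral => s; rewrite inE/=.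
rewrite in_itv/= => /andP[t0s st]; rewrite patchE ifT// inE/= in_itv/= t0s.
exact: le_trans ttf.
Qed.

Lemma primitive_left g : primitive g t0 = 0.
Proof. by rewrite /primitive set_itv1 Rintegral_set1. Qed.

Lemma integrable_patch g : mu.-integrable D (EFin \o g) ->
  mu.-integrable setT (EFin \o (g \_ D)).
Proof. by move=> ig; rewrite -restrict_EFin; apply/integrable_restrict; rewrite ?setTI. Qed.

Lemma primitive_sub g a b : mu.-integrable D (EFin \o g) -> t0 <= a -> a <= b ->
  `|primitive g b - primitive g a| <= \int[mu]_(s in `]a, b]) `|(g \_ D) s|.
Proof.
move=> /integrable_patch ig t0a ab.
have igS A : measurable A -> mu.-integrable A (EFin \o (g \_ D)).
  by move=> mA; apply: integrableS ig.
rewrite /primitive Rintegral_itvB//; last exact: igS.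
by apply: le_normr_Rintegral => //; exact: igS.
Qed.

Lemma acfun_primitive g : mu.-integrable D (EFin \o g) -> acfun t0 tf (primitive g).
Proof.
move=> ig e e0; have igT := integrable_patch ig.
have [d [d0 dP]] := integral_normr_continuous igT e0.
exists d => // k a b [sab dab] abd.
pose F (i : 'I_k) : set R := `]a i, b i]%classic.
have mF i : measurable (F i) by exact: measurable_itv.
pose U := \big[setU/set0]_(i <- index_enum 'I_k) F i.
have mU : measurable U by apply: bigsetU_measurable.
have inorm A : measurable A -> mu.-integrable A (EFin \o (fun x => `|(g \_ D) x|)).
  move=> mA; apply: (integrableS measurableT) => //.
  exact: integrable_norm.
apply: (@le_lt_trans _ _ (\int[mu]_(x in U) `|(g \_ D) x|)).
  rewrite -lee_fin [leRHS]fineK; last first.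
    by apply: integrable_fin_num => //; exact: inorm.
  rewrite integral_bigsetU_EFin//.
  - rewrite -sumEFin; apply: lee_sum => i _.
    have [t0a [ab btf]] := sab i.
    rewrite -[leRHS]fineK; last first.
      by apply: integrable_fin_num; [exact: mF|exact: inorm (mF i)].
    by rewrite lee_fin; exact: primitive_sub.
  - exact: index_enum_uniq.
  - move=> i j _ _ [x [xi xj]]; apply/eqP/negPn/negP => ij.
    have : x \in `]a i, b i]%R by exact: xi.
    have : x \in `]a j, b j]%R by exact: xj.
    rewrite !in_itv/= => /andP[ajx xbj] /andP[aix xbi].
    by have [h|h] := dab _ _ ij; lra.
  - by have /integrableP[] := inorm _ mU.
apply: dP => //; move: abd; rewrite -lte_fin; apply: le_lt_trans.
rewrite -sumEFin.
apply: (@le_trans _ _ (\sum_(i <- index_enum 'I_k) mu (F i))%E).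
  rewrite /U; elim: (index_enum 'I_k) => [|i r IH].
    by rewrite !big_nil measure0.
  rewrite !big_cons; apply: le_trans (measureU2 _ _ _) _.
  - exact: mF.
  - by apply: bigsetU_measurable => ? _; exact: mF.
  - by rewrite leeD2l.
apply: lee_sum => i _; rewrite [leLHS]lebesgue_measure_itv/= lte_fin.
by case: ltP => // h; rewrite lee_fin subr_ge0; have [_ []] := sab i.
Qed.

Lemma primitive_ac_deriv g : mu.-integrable D (EFin \o g) ->
  ac_deriv t0 tf (primitive g) g.
Proof.
move=> ig; split; first exact: acfun_primitive.
have igT := integrable_patch ig.
have := @FTC1 R (g \_ D) (BLeft t0); set P := (X in X -> _ -> _) => H.
have /H{H} : P by move=> y; apply: integrableS igT.
move=> /(_ (integrable_locally_restrict (measurable_itv _) ig)).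
(* the single point t0, which the fundamental theorem leaves out, is negligible *)
have : {ae mu, forall t, t != t0}.
  exists [set t0]; split; [exact: measurable_set1|exact: lebesgue_measure_set1|].
  by move=> t /= /negP; rewrite negbK => /eqP.
apply: aeS2 => t tt0 + Dt; move: (Dt); rewrite /= in_itv/= => /andP[t0t ttf].
have t0t' : (t0%:E < t%:E)%E by rewrite lte_fin lt_neqAle eq_sym tt0.
move=> /(_ t0t')[dF F'].
have -> : g t = (g \_ D) t by rewrite patchE ifT// inE.
by rewrite -F' derive1E; exact: derivableP.
Qed.

Lemma ac_deriv_primitive f g t : mu.-integrable D (EFin \o g) ->
  ac_deriv t0 tf f g -> D t -> f t = f t0 + primitive g t.
Proof.
move=> ig dfg Dt; apply: (ac_deriv_unique (g := fun s => f t0 + primitive g s) dfg) => //.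
  have := ac_derivD (ac_deriv_cst t0 tf (f t0)) (primitive_ac_deriv ig).
  by under [X in ac_deriv _ _ _ X]eq_fun do rewrite add0r.
by rewrite primitive_left addr0.
Qed.

Lemma le_norm_primitive g h t : mu.-integrable D (EFin \o g) ->
  mu.-integrable D (EFin \o h) -> (forall s, D s -> `|g s| <= h s) ->
  D t -> `|primitive g t| <= primitive h t.
Proof.
move=> ig ih gh Dt.
have DS : `[t0, t]%classic `<=` D.
  move: Dt => /=; rewrite in_itv/= => /andP[t0t ttf] s /=.
  by rewrite !in_itv/= => /andP[-> /le_trans ->].
have mD : measurable (D : set R) by exact: measurable_itv.
have mt : measurable (`[t0, t]%classic : set R) by exact: measurable_itv.
rewrite !primitiveE//; apply: le_trans (le_normr_Rintegral _ _) _ => //.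
  exact: integrableS ig.
apply: le_Rintegral => //.
- by apply: integrable_norm; exact: integrableS ig.
- exact: integrableS ih.
- by move=> s ts; apply/gh/DS.
Qed.

End Primitive.

(** * Picard iteration for linear equations *)

Section GeometricLimit.
Context {R : realType}.

Lemma le_geometric0 (r M : R) : (forall k, r <= M / 2 ^+ k) -> r <= 0.
Proof.
move=> H; rewrite leNgt; apply/negP => r0.
have M0 : 0 < M by have := H 0%N; rewrite expr0 divr1; exact: lt_le_trans.
have := archi_boundP (ltW (divr_gt0 M0 r0)); set k := Num.bound _ => Mrk.
have := H k; rewrite ler_pdivlMr ?exprn_gt0// leNgt => /negP; apply.
rewrite mulrC -ltr_pdivrMr//; apply: lt_le_trans Mrk _.
by rewrite -natrX ler_nat ltnW// ltn_expl.
Qed.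

(** Limit of a sequence whose increments are dominated by C / 2 ^ k, as the
    supremum of the nondecreasing sequence a k - 2 C / 2 ^ k. *)
Definition geo_limit (C : R) (a : nat -> R) : R :=
  sup (range (fun k => a k - 2 * C / 2 ^+ k)).

Lemma geo_limitP (C : R) (a : nat -> R) :
  (forall k, `|a k.+1 - a k| <= C / 2 ^+ k) ->
  forall k, `|a k - geo_limit C a| <= 2 * C / 2 ^+ k.
Proof.
move=> aC.
pose lo k := a k - 2 * C / 2 ^+ k; pose hi k := a k + 2 * C / 2 ^+ k.
have C0 k : 0 <= C / 2 ^+ k by apply: le_trans (aC k).
have half k : 2 * C / 2 ^+ k.+1 = C / 2 ^+ k.
  by rewrite exprS; field; rewrite expf_neq0.
have dbl k : 2 * C / 2 ^+ k = C / 2 ^+ k + C / 2 ^+ k by ring.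
have lo_nd : {homo lo : m n / (m <= n)%N >-> m <= n}.
  apply: homo_leq => //; first exact: le_trans.
  by move=> k; rewrite /lo half dbl; have := aC k; rewrite ler_norml; lra.
have hi_ni : {homo hi : m n / (m <= n)%N >-> m >= n}.
  apply: homo_leq => //; first by move=> x y z xy zx; exact: le_trans zx xy.
  by move=> k; rewrite /hi half dbl; have := aC k; rewrite ler_norml; lra.
have lohi m k : lo m <= hi k.
  apply: le_trans (lo_nd _ _ (leq_maxl m k)) _.
  apply: le_trans (hi_ni _ _ (leq_maxr m k)).
  by rewrite /lo /hi; have := C0 (maxn m k); rewrite dbl; lra.
have hs : has_sup (range lo).
  by split; [exists (lo 0%N), 0%N | exists (hi 0%N) => _ [m _ <-]].
move=> k; have h1 : lo k <= geo_limit C a by apply: sup_ubound hs.2 _ _; exists k.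
have h2 : geo_limit C a <= hi k.
  by apply: sup_le_ub hs.1 _ => _ [m _ <-].
by move: h1 h2; rewrite /lo /hi ler_norml; lra.
Qed.

Lemma geo_limit_cvg (C : R) (a : nat -> R) :
  (forall k, `|a k.+1 - a k| <= C / 2 ^+ k) -> a @ \oo --> geo_limit C a.
Proof.
move=> aC; apply/cvgrPdist_le => e e0.
have C0 : 0 <= C by have := le_trans (normr_ge0 _) (aC 0%N); rewrite expr0 divr1.
have := archi_boundP (divr_ge0 (mulr_ge0 (ler0n R 2) C0) (ltW e0)).
set N := Num.bound _ => NP; exists N => // k /= Nk.
rewrite distrC; apply: (le_trans (geo_limitP aC k)).
rewrite ler_pdivrMr ?exprn_gt0// -ler_pdivrMl// mulrC.
apply: le_trans (ltW NP) _; rewrite -natrX ler_nat (leq_trans Nk)//.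
by rewrite ltnW// ltn_expl.
Qed.

End GeometricLimit.

Section Picard.
Context {R : realType} (t0 tf : R).
Notation mu := (@lebesgue_measure R).
Notation D := `[t0, tf]%classic.

(** The weight exp (L (s - t0)) gains a factor 1 / L under integration. *)
Lemma primitive_expR (L t : R) : D t ->
  primitive t0 tf (fun s => L * expR (L * (s - t0))) t = expR (L * (t - t0)) - 1.
Proof.
move=> Dt; rewrite primitiveE//; move: Dt; rewrite /= in_itv/= => /andP[t0t _].
have [->|t0t'] := eqVneq t t0.
  by rewrite set_itv1 Rintegral_set1 subrr mulr0 expR0 subrr.
have dE (x : R) : is_derive x 1 (fun s => expR (L * (s - t0))) (L * expR (L * (x - t0))).
  by apply: is_derive_eq; rewrite /GRing.scale/=; ring.
have cE : continuous (fun s : R => expR (L * (s - t0))).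
  by move=> x; apply/differentiable_continuous/derivable1_diffP; have [] := dE x.
rewrite /Rintegral (@continuous_FTC2 _ _ (fun s => expR (L * (s - t0)))).
- by rewrite subrr mulr0 expR0.
- by rewrite lt_neqAle eq_sym t0t'.
- apply: continuous_subspaceT => x; apply: cvgM; first exact: cvg_cst.
  exact: cE.
- split=> [x _||]; first by have [] := dE x.
    exact/cvg_at_right_filter/cE.
  exact/cvg_at_left_filter/cE.
- by move=> x _; rewrite derive1E; have [_ ->] := dE x.
Qed.

Lemma bmfun_mulmx (m n p : nat) (A : R -> 'M[R]_(m, n)) (B : R -> 'M[R]_(n, p)) :
  (forall i j, bmfun t0 tf (fun t => A t i j)) ->
  (forall i j, bmfun t0 tf (fun t => B t i j)) ->
  forall i j, bmfun t0 tf (fun t => (A t *m B t) i j).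
Proof.
move=> bA bB i j; under eq_fun do rewrite mxE.
by apply: bmfun_sum => l; exact: bmfunM.
Qed.

Lemma bmfun_mx_bound (m n : nat) (A : R -> 'M[R]_(m, n)) :
  (forall i j, bmfun t0 tf (fun t => A t i j)) ->
  exists2 K : R, 0 <= K & forall t, D t -> forall i j, `|A t i j| <= K.
Proof.
move=> bA; have /choice[M MP] (p : 'I_m * 'I_n) : exists M : R,
    forall t, D t -> `|A t p.1 p.2| <= M by have [_] := bA p.1 p.2.
exists (\sum_p `|M p|); first exact: sumr_ge0.
move=> t Dt i j; rewrite (bigD1 (i, j))//= ler_wpDr ?sumr_ge0//.
by apply: le_trans (MP (i, j) t Dt) _; rewrite ler_norm.
Qed.

End Picard.

Section PicardExistence.
Context {R : realType} (t0 tf : R).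
Notation D := `[t0, tf]%classic.
Notation bmfun := (bmfun t0 tf).
Notation primitive := (primitive t0 tf).

Lemma primitiveB (g h : R -> R) t : bmfun g -> bmfun h -> D t ->
  primitive g t - primitive h t = primitive (fun s => g s - h s) t.
Proof.
move=> bg bh Dt; have ig := bmfun_integrable bg; have ih := bmfun_integrable bh.
apply/eqP; rewrite subr_eq; apply/eqP.
have igh : lebesgue_measure.-integrable D (EFin \o (fun s => g s - h s)).
  exact: bmfun_integrable (bmfunD bg (bmfunN bh)).
have dgh := ac_derivD (primitive_ac_deriv igh) (primitive_ac_deriv ih).
have := ac_deriv_unique (primitive_ac_deriv ig) (ac_deriv_eq _ dgh) _ Dt.
by apply=> [s _|]; rewrite ?subrK// !primitive_left addr0.
Qed.

Lemma primitiveZl (c : R) (g : R -> R) t : bmfun g -> D t ->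
  primitive (fun s => c * g s) t = c * primitive g t.
Proof.
move=> bg Dt; have icg := bmfun_integrable (bmfunM (bmfun_cst t0 tf c) bg).
have dg := ac_derivM (ac_deriv_cst t0 tf c) (primitive_ac_deriv (bmfun_integrable bg)).
have := ac_deriv_unique (primitive_ac_deriv icg) (ac_deriv_eq _ dg) _ Dt.
by apply=> [s _|]; rewrite ?mul0r ?add0r// !primitive_left mulr0.
Qed.

Lemma mxBE (m n : nat) (X Y : 'M[R]_(m, n)) i j : (X - Y) i j = X i j - Y i j.
Proof. by rewrite !mxE. Qed.

(** Coefficients need only be bounded and measurable. *)
Lemma linear_ode_exists (n : nat) (A : R -> 'M[R]_n) (v : 'cV[R]_n) : t0 <= tf ->
  (forall i j, bmfun (fun t => A t i j)) ->
  exists2 x : R -> 'cV[R]_n, x t0 = v &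
    forall i, ac_deriv t0 tf (fun t => x t i 0) (fun t => (A t *m x t) i 0).
Proof.
move=> t0tf bA; have [K K0 AK] := bmfun_mx_bound bA.
pose step (x : R -> 'cV[R]_n) (t : R) : 'cV[R]_n :=
  \col_i (v i 0 + primitive (fun s => (A s *m x s) i 0) t).
pose bv (x : R -> 'cV[R]_n) := forall i j, bmfun (fun t => x t i j).
have bvB x y : bv x -> bv y -> bv (fun t => x t - y t).
  move=> bx bY i j; under eq_fun do rewrite mxBE.
  by apply: bmfunD => //; exact: bmfunN.
have bAx x : bv x -> bv (fun s => A s *m x s) by move=> bx; exact: bmfun_mulmx.
have dstep x : bv x -> forall i,
    ac_deriv t0 tf (fun t => step x t i 0) (fun t => (A t *m x t) i 0).
  move=> bx i; under eq_fun do rewrite mxE.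
  have := ac_derivD (ac_deriv_cst t0 tf (v i 0))
    (primitive_ac_deriv (bmfun_integrable (bAx _ bx i 0))).
  by under [X in ac_deriv _ _ _ X]eq_fun do rewrite add0r.
have bstep x : bv x -> bv (step x).
  by move=> bx i j; rewrite ord1; have [/acfun_bmfun] := dstep _ bx i.
pose u k := iter k step (fun=> v).
have uS k : u k.+1 = step (u k) by [].
have bu k : bv (u k).
  elim: k => [|k IH] /=; first by move=> i j; exact: bmfun_cst.
  exact: bstep.
pose c := n%:R * K; have c0 : 0 <= c by rewrite mulr_ge0.
(* A multiplies the sup norm of a vector by at most c = n K *)
have Ac t (w : 'cV[R]_n) (e : R) : D t -> (forall i, `|w i 0| <= e) ->
    forall i, `|(A t *m w) i 0| <= c * e.
  move=> Dt we i; rewrite mxE; apply: le_trans (ler_norm_sum _ _ _) _.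
  apply: (@le_trans _ _ (\sum_(j < n) K * e)).
    by apply: ler_sum => j _; rewrite normrM ler_pM// AK.
  by rewrite sumr_const card_ord -mulr_natl mulrA.
(* c / L <= 1 / 2, so that each iteration halves the weighted increment *)
pose L := 2 * c + 1; have L0 : 0 < L by rewrite /L; lra.
pose E t := expR (L * (t - t0)).
have bE : bmfun (fun t => L * E t).
  apply: continuous_bmfun; apply: continuous_subspaceT => t.
  apply: cvgM; first exact: cvg_cst.
  apply: continuous_comp; last exact: continuous_expR.
  by apply: cvgM; [exact: cvg_cst|apply: cvgB => //; exact: cvg_cst].
have [C [C0 uC]] : exists C : R, 0 <= C /\
    forall k t, D t -> forall i, `|u k.+1 t i 0 - u k t i 0| <= C / 2 ^+ k * E t.
  have [C C0 CP] := bmfun_mx_bound (bvB _ _ (bu 1%N) (bu 0%N)).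
  exists C; split=> //; elim=> [|k IH] t Dt i.
      rewrite expr0 divr1; have := CP _ Dt i 0; rewrite !mxE => /le_trans; apply.
      rewrite ler_peMr// -expR0 ler_expR mulr_ge0 ?(ltW L0)// subr_ge0.
      by move: Dt; rewrite /= in_itv/= => /andP[].
    have -> : u k.+2 t i 0 - u k.+1 t i 0 =
        primitive (fun s => (A s *m (u k.+1 s - u k s)) i 0) t.
      rewrite (uS k.+1) [in X in _ - X](uS k) /step.
      rewrite !mxE opprD addrACA subrr add0r primitiveB//; [|exact: bAx..].
      by congr (primitive _ t); apply/funext => s; rewrite mulmxBr mxBE.
    pose d := C / 2 ^+ k.+1.
    have d0 : 0 <= d by rewrite divr_ge0// exprn_ge0.
    apply: le_trans (le_norm_primitive (h := fun s => d * (L * E s)) _ _ _ Dt) _.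
    - exact/bmfun_integrable/bAx/bvB.
    - by apply/bmfun_integrable/bmfunM => //; exact: bmfun_cst.
    - move=> s Ds; apply: le_trans (Ac _ _ (C / 2 ^+ k * E s) Ds _ i) _.
        by move=> j; rewrite mxBE; exact: IH.
      have -> : C / 2 ^+ k = 2 * d.
        by rewrite /d exprS; field; rewrite expf_neq0.
      have : 0 <= d * E s by rewrite mulr_ge0// expR_ge0.
      by rewrite /L; nra.
    - rewrite primitiveZl// primitive_expR// ler_wpM2l//.
      by rewrite lerBlDr lerDl.
pose C' := C * E tf.
have C'0 : 0 <= C' by rewrite mulr_ge0// expR_ge0.
have uC' t : D t -> forall i k, `|u k.+1 t i 0 - u k t i 0| <= C' / 2 ^+ k.
  move=> Dt i k; apply: le_trans (uC _ _ Dt i) _.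
  rewrite /C' [leRHS]mulrAC ler_wpM2l ?divr_ge0 ?exprn_ge0//.
  rewrite ler_expR ler_wpM2l ?(ltW L0)// lerB//.
  by move: Dt; rewrite /= in_itv/= => /andP[].
pose x t : 'cV[R]_n := \col_i geo_limit C' (fun k => u k t i 0).
have ux t : D t -> forall i k, `|u k t i 0 - x t i 0| <= 2 * C' / 2 ^+ k.
  by move=> Dt i k; rewrite mxE; apply: geo_limitP; exact: uC'.
have bx : bv x.
  move=> i j; rewrite ord1; split.
    apply: (measurable_fun_cvg (h := fun k t => u k t i 0)).
      by move=> k; have [] := bu k i 0.
    by move=> t Dt; rewrite mxE; apply: geo_limit_cvg; exact: uC'.
  have [_ [M uM]] := bu 0%N i 0.
  exists (M + 2 * C') => t Dt; have := ux _ Dt i 0%N; have := uM _ Dt.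
  by rewrite expr0 divr1 !ler_norml; lra.
(* x is a fixed point: both x t and step x t are within a multiple of
   1 / 2 ^ k of the iterate u k.+1 t *)
have xE t : D t -> x t = step x t.
  move=> Dt; apply/colP => i; apply/eqP; rewrite -subr_eq0 -normr_le0.
  apply: (@le_geometric0 _ _ (C' + c * (2 * C') * primitive (fun=> 1) t)) => k.
  have : `|u k.+1 t i 0 - step x t i 0| <=
      c * (2 * C' / 2 ^+ k) * primitive (fun=> 1) t.
    have -> : u k.+1 t i 0 - step x t i 0 =
        primitive (fun s => (A s *m (u k s - x s)) i 0) t.
      rewrite uS /step.
      rewrite !mxE opprD addrACA subrr add0r primitiveB//; [|exact: bAx..].
      by congr (primitive _ t); apply/funext => s; rewrite mulmxBr mxBE.
    apply: le_trans (le_norm_primitive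
      (h := fun s => c * (2 * C' / 2 ^+ k) * 1) _ _ _ Dt) _.
    - exact/bmfun_integrable/bAx/bvB.
    - exact/bmfun_integrable/bmfun_cst.
    - move=> s Ds; rewrite mulr1; apply: Ac => // j; rewrite mxBE.
      exact: ux.
    - by rewrite primitiveZl//; exact: bmfun_cst.
  have := ux _ Dt i k.+1.
  have -> : 2 * C' / 2 ^+ k.+1 = C' / 2 ^+ k.
    by rewrite exprS; field; rewrite expf_neq0.
  have -> : (C' + c * (2 * C') * primitive (fun=> 1) t) / 2 ^+ k =
    C' / 2 ^+ k + c * (2 * C' / 2 ^+ k) * primitive (fun=> 1) t by ring.
  by rewrite !ler_norml; lra.
exists (step x).
  by apply/colP => i; rewrite mxE primitive_left addr0.
move=> i; apply: ac_deriv_eq (dstep _ bx i) => t Dt.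
by rewrite -xE.
Qed.

End PicardExistence.

(** * Square-integrable functions *)

Section SquareIntegrable.
Context {R : realType} (t0 tf : R).
Implicit Types f g : R -> R.
Notation mu := (@lebesgue_measure R).
Notation D := `[t0, tf]%classic.
Notation bmfun := (bmfun t0 tf).

Let mD : measurable (D : set (measurableTypeR R)).
Proof. exact: measurable_itv. Qed.



(** Real-valued square-integrable functions on [t0, tf]. *)
Definition l2fun g : Prop :=
  measurable_fun D g /\ mu.-integrable D (EFin \o (fun t => g t ^+ 2)).

Lemma l2fun_le f g (h : R -> R) : measurable_fun D h -> l2fun f -> l2fun g ->
  (forall t, D t -> `|h t| <= f t ^+ 2 + g t ^+ 2) ->
  mu.-integrable D (EFin \o h).
Proof.
move=> mh [mf if2] [mg ig2] hfg.
apply: (le_integrable mD _ _ (integrableD mD if2 ig2)) => //; first exact/measurable_EFinP.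
move=> t Dt /=; rewrite lee_fin; apply: le_trans (hfg t Dt) _.
by rewrite ler_norm.
Qed.

Lemma l2funM f g : l2fun f -> l2fun g -> mu.-integrable D (EFin \o (fun t => f t * g t)).
Proof.
move=> l2f l2g; apply: (l2fun_le _ l2f l2g).
  by apply: measurable_funM; [case: l2f|case: l2g].
by move=> t _; rewrite ler_norml; apply/andP; split; nra.
Qed.

Lemma l2funZ (c : R) g : l2fun g -> l2fun (fun t => c * g t).
Proof.
move=> [mg ig2]; split; first by apply: measurable_funM.
have := integrableZl mD (c ^+ 2) ig2; apply: eq_integrable => // t _ /=.
by rewrite exprMn EFinM.
Qed.

Lemma l2funD f g : l2fun f -> l2fun g -> l2fun (fun t => f t + g t).
Proof.
move=> l2f l2g; have mfg : measurable_fun D (fun t => f t + g t).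
  by apply: measurable_funD; [case: l2f|case: l2g].
split=> //; apply: (l2fun_le _ (l2funZ 2 l2f) (l2funZ 2 l2g)).
  exact: measurable_funX.
by move=> t _; rewrite ger0_norm ?sqr_ge0//; nra.
Qed.

Lemma bmfun_l2funM f g : bmfun f -> l2fun g -> l2fun (fun t => f t * g t).
Proof.
move=> [mf [M fM]] l2g; have mfg : measurable_fun D (fun t => f t * g t).
  by apply: measurable_funM => //; case: l2g.
split=> //; apply: (l2fun_le _ (l2funZ M l2g) (l2funZ M l2g)).
  exact: measurable_funX.
move=> t Dt; rewrite ger0_norm ?sqr_ge0// !exprMn.
have fM2 : f t ^+ 2 <= M ^+ 2.
  by rewrite -[f t ^+ 2]real_normK ?num_real// ler_sqr ?nnegrE ?fM// (le_trans _ (fM t Dt)).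
have : 0 <= g t ^+ 2 by rewrite sqr_ge0.
have : 0 <= M ^+ 2 by rewrite sqr_ge0.
by nra.
Qed.

Lemma bmfun_l2fun f : bmfun f -> l2fun f.
Proof.
move=> bf; split; first by case: bf.
by have := bmfun_integrable (bmfunM bf bf).
Qed.

Lemma l2fun_integrable f : l2fun f -> mu.-integrable D (EFin \o f).
Proof.
move=> l2f; have := l2funM (bmfun_l2fun (bmfun_cst t0 tf 1)) l2f.
by under [X in EFin \o X]eq_fun do rewrite mul1r.
Qed.

Lemma l2fun_sum (I : Type) (r : seq I) (F : I -> R -> R) :
  (forall i, l2fun (F i)) -> l2fun (fun t => \sum_(i <- r) F i t).
Proof.
move=> lF; elim: r => [|i r IH].
  by under eq_fun do rewrite big_nil; exact: bmfun_l2fun (bmfun_cst _ _ _).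
by under eq_fun do rewrite big_cons; exact: l2funD.
Qed.

Lemma enorm_sqr (q : nat) (v : 'cV[R]_q) : enorm v ^+ 2 = \sum_i v i 0 ^+ 2.
Proof. by rewrite sqr_sqrtr// sumr_ge0// => i _; rewrite sqr_ge0. Qed.

(** Membership in L2 is decided coordinatewise. *)
Lemma L2P (q : nat) (z : R -> 'cV[R]_q) :
  L2 t0 tf z <-> forall i, l2fun (fun t => z t i 0).
Proof.
split=> [[mz iz] i|lz].
  split=> //; apply/integrableP; split.
    by apply/measurable_EFinP; apply: measurable_funX; exact: mz.
  apply: le_lt_trans iz; apply: ge0_le_integral => //.
  - apply/measurable_EFinP; apply: measurableT_comp => //; by apply: measurable_funX; exact: mz.
  - under [X in measurable_fun _ X]eq_fun do rewrite enorm_sqr.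
    apply/measurable_EFinP.
    by apply: measurable_sum => j; by apply: measurable_funX; exact: mz.
  - move=> t _ /=; rewrite lee_fin ger0_norm ?sqr_ge0// enorm_sqr.
    by rewrite (bigD1 i)//= lerDl sumr_ge0// => j _; rewrite sqr_ge0.
split=> [i|]; first by have [] := lz i.
under eq_integral do rewrite enorm_sqr -sumEFin.
apply: integrable_lty => //; have H := @integrable_sum _ _ _ mu _ mD _ (index_enum 'I_q) xpredT
  (fun i t => (z t i 0 ^+ 2)%:E).
by apply: H => i _; have [_] := lz i.
Qed.

End SquareIntegrable.

(** * Vector-valued functions, coordinate by coordinate *)

Section VectorAC.
Context {R : realType} (t0 tf : R).
Notation mu := (@lebesgue_measure R).
Notation D := `[t0, tf]%classic.

Lemma ae_forall_fin (I : finType) (P : I -> R -> Prop) :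
  (forall i, {ae mu, forall t, P i t}) -> {ae mu, forall t, forall i, P i t}.
Proof. by move=> aP; apply: filter_forall. Qed.

Lemma col_norm_le_sum (q : nat) (v : 'cV[R]_q) : `|v| <= \sum_i `|v i 0|.
Proof.
rewrite [leLHS]/Num.Def.normr/= mx_normrE; apply: bigmax_le; first exact: sumr_ge0.
by move=> [i j] _ /=; rewrite ord1 (bigD1 i)//= lerDl sumr_ge0.
Qed.

Lemma col_coord_le_norm (q : nat) (v : 'cV[R]_q) i : `|v i 0| <= `|v|.
Proof.
rewrite [leRHS]/Num.Def.normr/= mx_normrE.
exact: (le_bigmax _ (fun ij : 'I_q * 'I_1 => `|v ij.1 ij.2|) (i, 0)).
Qed.

Lemma absolutely_continuousP (q : nat) (z : R -> 'cV[R]_q) :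
  absolutely_continuous t0 tf z <-> forall i, acfun t0 tf (fun t => z t i 0).
Proof.
split=> [acz i e e0|acz e e0].
  have [d d0 dP] := acz _ e0; exists d => // k a b [sab dab] abd.
  apply: le_lt_trans (dP k a b sab dab abd); apply: ler_sum => j _.
  by rewrite -mxBE col_coord_le_norm.
have e'0 : 0 < e / (q%:R + 1) by rewrite divr_gt0// ltr_wpDl.
have /choice[d dP] i : exists d : R, 0 < d /\
    forall (k : nat) (a b : 'I_k -> R), disjoint_intervals t0 tf a b ->
      \sum_(i < k) (b i - a i) < d ->
      \sum_(j < k) `|z (b j) i 0 - z (a j) i 0| < e / (q%:R + 1).
  by have [d d0 dP] := acz i _ e'0; exists d.
exists (\big[Num.min/1]_i d i).
  by apply: lt_bigmin => // i _; have [] := dP i.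
move=> k a b sab dab abd.
apply: (@le_lt_trans _ _ (\sum_(i < q) e / (q%:R + 1))).
  apply: (@le_trans _ _ (\sum_(j < k) \sum_(i < q) `|z (b j) i 0 - z (a j) i 0|)).
    apply: ler_sum => j _; apply: le_trans (col_norm_le_sum _) _.
    by apply: ler_sum => i _; rewrite mxBE.
  rewrite exchange_big; apply: ler_sum => i _; apply/ltW.
  have [_] := dP i; apply=> //; apply: lt_le_trans abd _.
  exact: bigmin_le.
rewrite sumr_const card_ord -(mulr_natl (e / _)) mulrA ltr_pdivrMr; last by rewrite ltr_wpDl.
by rewrite mulrC ltr_pM2l// ltrDl.
Qed.

Lemma is_derive_colP (q : nat) (z : R -> 'cV[R]_q) (t : R) (dz : 'cV[R]_q) :
  is_derive t 1 z dz <-> forall i, is_derive t 1 (fun s => z s i 0) (dz i 0).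
Proof.
split=> [[dz1 dz2] i|dzi].
  split; first by move/derivable_mxP : dz1; apply.
  by rewrite -dz2 derive_mx// mxE.
have dz1 : derivable z t 1 by apply/derivable_mxP => i j; rewrite ord1; have [] := dzi i.
split=> //; rewrite derive_mx//; apply/matrixP => i j; rewrite ord1 mxE.
by have [] := dzi i.
Qed.

Lemma ae_derivativeP (q : nat) (z dz : R -> 'cV[R]_q) :
  ae_derivative t0 tf z dz <-> forall i,
    {ae mu, forall t, D t -> is_derive t 1 (fun s => z s i 0) (dz t i 0)}.
Proof.
split=> [aez i|aez].
  by apply: aeS aez => t h Dt; move: (h Dt) => /is_derive_colP.
by apply: aeS (ae_forall_fin aez) => t h Dt; apply/is_derive_colP => i; exact: h.
Qed.

(** Entrywise [ac_deriv] for matrix-valued functions. *)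
Definition ac_deriv_mx (p q : nat) (X X' : R -> 'M[R]_(p, q)) : Prop :=
  forall i j, ac_deriv t0 tf (fun t => X t i j) (fun t => X' t i j).

Lemma ac_deriv_mx_eq (p q : nat) (X X' Y' : R -> 'M[R]_(p, q)) :
  (forall t, D t -> X' t = Y' t) -> ac_deriv_mx X X' -> ac_deriv_mx X Y'.
Proof. by move=> XY dX i j; apply: ac_deriv_eq (dX i j) => t /XY ->. Qed.

Lemma ac_deriv_mxM (p q r : nat) (X X' : R -> 'M[R]_(p, q)) (Y Y' : R -> 'M[R]_(q, r)) :
  ac_deriv_mx X X' -> ac_deriv_mx Y Y' ->
  ac_deriv_mx (fun t => X t *m Y t) (fun t => X' t *m Y t + X t *m Y' t).
Proof.
move=> dX dY i j; under eq_fun do rewrite mxE.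
under [X in ac_deriv _ _ _ X]eq_fun do rewrite !mxE -big_split/=.
by apply: ac_deriv_sum => l; exact: ac_derivM.
Qed.

Lemma ac_deriv_mx_cst_eq (p q : nat) (X X' : R -> 'M[R]_(p, q)) t :
  ac_deriv_mx X X' -> (forall s, D s -> X' s = 0) -> D t -> X t = X t0.
Proof.
move=> dX X'0 Dt; apply/matrixP => i j; apply: (ac_deriv_cst_eq (dX i j)) => //.
by move=> s Ds; rewrite X'0// mxE.
Qed.

Lemma ac_deriv_mx_bm (p q : nat) (X X' : R -> 'M[R]_(p, q)) i j :
  ac_deriv_mx X X' -> bmfun t0 tf (fun t => X t i j).
Proof. by move=> /(_ i j)[/acfun_bmfun]. Qed.

Lemma W12_ac_deriv (q : nat) (z dz : R -> 'cV[R]_q) :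
  absolutely_continuous t0 tf z -> ae_derivative t0 tf z dz -> ac_deriv_mx z dz.
Proof.
move=> /absolutely_continuousP acz /ae_derivativeP aez i j.
by rewrite ord1; split.
Qed.

Lemma ac_deriv_W12 (q : nat) (z dz : R -> 'cV[R]_q) : L2 t0 tf dz ->
  ac_deriv_mx z dz -> W12 t0 tf z /\ ae_derivative t0 tf z dz.
Proof.
move=> l2dz dz'; have aez : ae_derivative t0 tf z dz.
  by apply/ae_derivativeP => i; have [] := dz' i 0.
split=> //; split.
- by apply/absolutely_continuousP => i; have [] := dz' i 0.
- by apply/L2P => i; apply/bmfun_l2fun/(ac_deriv_mx_bm _ _ dz').
- by exists dz.
Qed.

End VectorAC.

Section VectorIntegral.
Context {R : realType} (t0 tf : R).
Notation mu := (@lebesgue_measure R).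
Notation D := `[t0, tf]%classic.

Let mD : measurable (D : set (measurableTypeR R)).
Proof. exact: measurable_itv. Qed.

Lemma Rintegral_lincomb (I : Type) (r : seq I) (F : I -> R -> R) (c : I -> R) :
  (forall i, mu.-integrable D (EFin \o F i)) ->
  \int[mu]_(t in D) (\sum_(i <- r) c i * F i t) =
  \sum_(i <- r) c i * \int[mu]_(t in D) F i t.
Proof.
move=> iF.
have icF i : mu.-integrable D (EFin \o (fun t => c i * F i t)).
  by have := integrableZl mD (c i) (iF i); apply: eq_integrable.
have isF s : mu.-integrable D (EFin \o (fun t => \sum_(i <- s) c i * F i t)).
  have H := @integrable_sum _ _ _ mu _ mD _ s xpredT (fun i t => (c i * F i t)%:E).
  have := H (fun i _ => icF i); apply: eq_integrable => // t _ /=.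
  by rewrite sumEFin.
elim: r => [|i r IH].
  rewrite big_nil; under eq_Rintegral do rewrite big_nil.
  by rewrite Rintegral_cst// mul0r.
rewrite big_cons; under eq_Rintegral do rewrite big_cons.
by rewrite RintegralD// RintegralZl// IH.
Qed.

Lemma eq_vint (q : nat) (f g : R -> 'cV[R]_q) : (forall t, D t -> f t = g t) ->
  vint t0 tf f = vint t0 tf g.
Proof.
move=> fg; apply/colP => i; rewrite !mxE; apply: eq_Rintegral => t.
by rewrite inE => Dt; rewrite fg.
Qed.

Lemma L2_integrable (q : nat) (f : R -> 'cV[R]_q) i : L2 t0 tf f ->
  mu.-integrable D (EFin \o (fun t => f t i 0)).
Proof. by move/L2P => /(_ i)/l2fun_integrable. Qed.

Lemma vint_mulmx (p q : nat) (M : 'M[R]_(p, q)) (f : R -> 'cV[R]_q) : L2 t0 tf f ->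
  vint t0 tf (fun t => M *m f t) = M *m vint t0 tf f.
Proof.
move=> lf; apply/colP => i; rewrite !mxE; under eq_Rintegral do rewrite mxE.
rewrite Rintegral_lincomb => [|j]; last exact: L2_integrable.
by apply: eq_bigr => j _; rewrite mxE.
Qed.

Lemma vintB (q : nat) (f g : R -> 'cV[R]_q) : L2 t0 tf f -> L2 t0 tf g ->
  vint t0 tf (fun t => f t - g t) = vint t0 tf f - vint t0 tf g.
Proof.
move=> lf lg; apply/colP => i; rewrite mxBE !mxE; under eq_Rintegral do rewrite mxBE.
by rewrite RintegralB//; exact: L2_integrable.
Qed.

Lemma L2_mulmx (p q : nat) (M : R -> 'M[R]_(p, q)) (f : R -> 'cV[R]_q) :
  (forall i j, bmfun t0 tf (fun t => M t i j)) -> L2 t0 tf f ->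
  L2 t0 tf (fun t => M t *m f t).
Proof.
move=> bM /L2P lf; apply/L2P => i; under eq_fun do rewrite mxE.
by apply: l2fun_sum => j; apply: bmfun_l2funM.
Qed.

Lemma L2D (q : nat) (f g : R -> 'cV[R]_q) : L2 t0 tf f -> L2 t0 tf g ->
  L2 t0 tf (fun t => f t + g t).
Proof.
move=> /L2P lf /L2P lg; apply/L2P => i; under eq_fun do rewrite mxE.
exact: l2funD.
Qed.

Lemma L2N (q : nat) (f : R -> 'cV[R]_q) : L2 t0 tf f -> L2 t0 tf (fun t => - f t).
Proof.
move=> /L2P lf; apply/L2P => i; under eq_fun do rewrite mxE -mulN1r.
exact: l2funZ.
Qed.

Lemma L2B (q : nat) (f g : R -> 'cV[R]_q) : L2 t0 tf f -> L2 t0 tf g ->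
  L2 t0 tf (fun t => f t - g t).
Proof. by move=> lf lg; exact: L2D lf (L2N lg). Qed.

Lemma bmfun_L2 (q : nat) (f : R -> 'cV[R]_q) :
  (forall i j, bmfun t0 tf (fun t => f t i j)) -> L2 t0 tf f.
Proof. by move=> bf; apply/L2P => i; apply: bmfun_l2fun. Qed.

Lemma continuous_mx_bmfun (p q : nat) (M : R -> 'M[R]_(p, q)) :
  {within D, continuous M} -> forall i j, bmfun t0 tf (fun t => M t i j).
Proof.
move=> cM i j; apply: continuous_bmfun => t.
exact: (continuous_comp (cM t) (@coord_continuous _ _ _ i j _)).
Qed.

End VectorIntegral.


(** * Variation of constants and the transition matrix *)

Section LinearSystem.
Context {R : realType} {n : nat} (t0 tf : R) (A : R -> 'M[R]_n).
Notation D := `[t0, tf]%classic.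
Notation ac_deriv_mx := (ac_deriv_mx t0 tf).

Lemma matrix_ode_exists : t0 <= tf ->
  (forall i j, bmfun t0 tf (fun t => A t i j)) ->
  exists2 X : R -> 'M[R]_n, X t0 = 1%:M & ac_deriv_mx X (fun t => A t *m X t).
Proof.
move=> t0tf bA.
have /choice[x xP] (j : 'I_n) : exists x : R -> 'cV[R]_n, x t0 = col j 1%:M /\
    forall i, ac_deriv t0 tf (fun t => x t i 0) (fun t => (A t *m x t) i 0).
  by have [x] := linear_ode_exists (col j 1%:M) t0tf bA; exists x.
exists (fun t => \matrix_(i, j) x j t i 0).
  by apply/matrixP => i j; rewrite mxE; have [-> _] := xP j; rewrite mxE.
move=> i j; under eq_fun do rewrite mxE.
under [X in ac_deriv _ _ _ X]eq_fun do rewrite mxE.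
have [_ /(_ i)] := xP j; apply: ac_deriv_eq => t _.
by rewrite mxE; apply: eq_bigr => k _; rewrite mxE.
Qed.

(** X is the fundamental matrix of the homogeneous equation, normalized at t0,
    and Y its pointwise inverse on [t0, tf], which solves the adjoint equation. *)
Definition fundamental_pair (X Y : R -> 'M[R]_n) : Prop :=
  [/\ X t0 = 1%:M, Y t0 = 1%:M,
      ac_deriv_mx X (fun t => A t *m X t),
      ac_deriv_mx Y (fun t => - (Y t *m A t)) &
      forall t, D t -> Y t *m X t = 1%:M /\ X t *m Y t = 1%:M].

End LinearSystem.

(** Y is the transpose of the fundamental matrix of z' = - A^T z; it inverts X
    because (Y X)' = 0. *)
Lemma fundamental_pair_exists (R : realType) (n : nat) (t0 tf : R) (A : R -> 'M[R]_n) :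
  t0 <= tf -> (forall i j, bmfun t0 tf (fun t => A t i j)) ->
  exists X Y, fundamental_pair t0 tf A X Y.
Proof.
move=> t0tf bA; have [X X0 dX] := matrix_ode_exists t0tf bA.
have bA' i j : bmfun t0 tf (fun t => (- (A t)^T) i j).
  by under eq_fun do rewrite !mxE; exact: bmfunN.
have [Z Z0 dZ] := matrix_ode_exists t0tf bA'.
exists X, (fun t => (Z t)^T).
have dY : ac_deriv_mx t0 tf (fun t => (Z t)^T) (fun t => - ((Z t)^T *m A t)).
  move=> i j; under eq_fun do rewrite mxE.
  apply: ac_deriv_eq (dZ j i) => t _.
  by rewrite -[in RHS](trmxK (A t)) -trmx_mul mulNmx !mxE.
have Y0 : (Z t0)^T = 1%:M by rewrite Z0 trmx1.
split=> // t Dt.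
have YX : (Z t)^T *m X t = 1%:M.
  rewrite (ac_deriv_mx_cst_eq (ac_deriv_mxM dY dX) _ Dt) => [|s _].
    by rewrite X0 Y0 mulmx1.
  by rewrite mulNmx mulmxA addNr.
by split=> //; exact: mulmx1C.
Qed.

Section VariationOfConstants.
Context {R : realType} {n : nat} (t0 tf : R) (A X Y : R -> 'M[R]_n).
Notation D := `[t0, tf]%classic.
Hypothesis t0tf : t0 <= tf.
Hypothesis bA : forall i j, bmfun t0 tf (fun t => A t i j).
Hypothesis XY : fundamental_pair t0 tf A X Y.

(** Coordinatewise indefinite integral from t0. *)
Definition vprimitive (q : nat) (f : R -> 'cV[R]_q) (t : R) : 'cV[R]_q :=
  \col_i primitive t0 tf (fun s => f s i 0) t.

Lemma vprimitive_end (q : nat) (f : R -> 'cV[R]_q) : vprimitive f tf = vint t0 tf f.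
Proof.
by apply/colP => i; rewrite !mxE primitiveE//= in_itv/= lexx t0tf.
Qed.

(** The formula of variation of constants, with initial value v at t0. *)
Definition response (v : 'cV[R]_n) (f : R -> 'cV[R]_n) (t : R) : 'cV[R]_n :=
  X t *m (v + vprimitive (fun s => Y s *m f s) t).

Lemma fundamental_bm : (forall i j, bmfun t0 tf (fun t => X t i j)) /\
  (forall i j, bmfun t0 tf (fun t => Y t i j)).
Proof.
have [_ _ dX dY _] := XY.
by split=> i j; [exact: ac_deriv_mx_bm dX|exact: ac_deriv_mx_bm dY].
Qed.

Lemma response_left v f : response v f t0 = v.
Proof.
have [X0 _ _ _ _] := XY; rewrite /response X0 mul1mx.
by apply/colP => i; rewrite !mxE primitive_left addr0.
Qed.

Lemma response_solves v f : L2 t0 tf f -> solves_ode t0 tf A f (response v f).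
Proof.
move=> lf; have [bX bY] := fundamental_bm; have [X0 Y0 dX dY iXY] := XY.
have lYf := L2_mulmx bY lf.
have dw : ac_deriv_mx t0 tf (fun t => v + vprimitive (fun s => Y s *m f s) t)
    (fun t => Y t *m f t).
  move=> i j; rewrite ord1; under eq_fun do rewrite !mxE.
  have := ac_derivD (ac_deriv_cst t0 tf (v i 0)) (primitive_ac_deriv (L2_integrable i lYf)).
  by under [X in ac_deriv _ _ _ X]eq_fun do rewrite add0r.
have dz : ac_deriv_mx t0 tf (response v f) (fun t => A t *m response v f t + f t).
  apply: ac_deriv_mx_eq (ac_deriv_mxM dX dw) => t Dt.
  by have [_ XYt] := iXY t Dt; rewrite /response !mulmxA XYt mul1mx.
apply: (ac_deriv_W12 _ dz); apply: (L2D _ lf); apply: (L2_mulmx bA).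
by apply: bmfun_L2 => i j; exact: ac_deriv_mx_bm dz.
Qed.

(** Uniqueness: every solution is given by the formula. *)
Lemma solves_response f x t : L2 t0 tf f -> solves_ode t0 tf A f x -> D t ->
  x t = response (x t0) f t.
Proof.
move=> lf [[acx _ _] aex] Dt; have [bX bY] := fundamental_bm.
have [X0 Y0 dX dY iXY] := XY; have [_ XYt] := iXY t Dt.
have dYx : ac_deriv_mx t0 tf (fun t => Y t *m x t) (fun t => Y t *m f t).
  apply: ac_deriv_mx_eq (ac_deriv_mxM dY (W12_ac_deriv acx aex)) => s _.
  by rewrite mulmxDr mulNmx mulmxA addKr.
rewrite /response -[LHS]mul1mx -XYt -mulmxA; congr (_ *m _).
apply/colP => i.
have := ac_deriv_primitive (L2_integrable i (L2_mulmx bY lf)) (dYx i 0) Dt.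
by rewrite Y0 mul1mx => ->; rewrite !mxE.
Qed.

Lemma response_homogeneous v t : response v (fun=> 0) t = X t *m v.
Proof.
rewrite /response; congr (_ *m _); apply/colP => i; rewrite !mxE.
have -> : (fun s => (Y s *m (0 : 'cV[R]_n)) i 0) = (fun s => 0).
  by apply/funext => s; rewrite mulmx0 mxE.
rewrite /primitive; under eq_Rintegral do rewrite patchE if_same.
by rewrite Rintegral_cst// mul0r addr0.
Qed.

(** The matrix is determined because every vector is the value at s of some
    solution of the homogeneous equation. *)
Lemma transition_matrixE s t : D s -> D t ->
  transition_matrix t0 tf A t s = X t *m Y s.
Proof.
move=> Ds Dt; have [X0 Y0 dX dY iXY] := XY.
have l0 : L2 t0 tf (fun=> 0 : 'cV[R]_n) by apply: bmfun_L2 => i j; exact: bmfun_cst.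
apply: xget_subset1.
  move=> x xsol; rewrite (solves_response l0 xsol Dt) (solves_response l0 xsol Ds).
  rewrite !response_homogeneous.
  by have [YXs _] := iXY s Ds; rewrite -mulmxA (mulmxA (Y s)) YXs mul1mx.
suff H P : (forall x : R -> 'cV[R]_n, solves_ode t0 tf A (fun=> 0) x -> x t = P *m x s) ->
    P = X t *m Y s by move=> P Q /H -> /H ->.
move=> HP; have [_ XYs] := iXY s Ds.
have HPv (v : 'cV[R]_n) : P *m v = X t *m Y s *m v.
  have := HP _ (response_solves (Y s *m v) l0).
  rewrite !response_homogeneous !mulmxA => ->.
  by rewrite -!mulmxA (mulmxA (X s)) XYs mul1mx.
apply/matrixP => i j; have /colP/(_ i) := HPv (delta_mx j 0).
by rewrite -!colE !mxE.
Qed.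

End VariationOfConstants.

(** * Jacobian of an affine map *)

Section AffineJacobian.
Context {R : realType}.

Lemma differentiable_mulmxr (p q : nat) (N : 'M[R]_(p, q)) (a : 'rV[R]_p) :
  differentiable (fun v : 'rV[R]_p => v *m N) a.
Proof.
have -> : (fun v : 'rV[R]_p => v *m N) =
    \sum_(j < p) (fun v : 'rV[R]_p => v 0 j *: row j N).
  by apply/funext => v; rewrite fct_sumE mulmx_sum_row.
apply: differentiable_sum => j.
apply: (@differentiable_comp _ _ _ _ (fun v : 'rV[R]_p => v 0 j : R)
  (fun r : R => r *: row j N)).
  exact: differentiable_coord.
exact: ex_diff.
Qed.

Lemma differentiable_mulmxl (p q : nat) (M : 'M[R]_(q, p)) (a : 'cV[R]_p) :
  differentiable (fun v : 'cV[R]_p => M *m v) a.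
Proof.
have -> : (fun v : 'cV[R]_p => M *m v) =
    \sum_(j < p) (fun v : 'cV[R]_p => v j 0 *: col j M).
  apply/funext => v; rewrite fct_sumE; apply/colP => i; rewrite summxE mxE.
  by apply: eq_bigr => j _; rewrite !mxE mulrC.
apply: differentiable_sum => j.
apply: (@differentiable_comp _ _ _ _ (fun v : 'cV[R]_p => v j 0 : R)
  (fun r : R => r *: col j M)).
  exact: differentiable_coord.
exact: ex_diff.
Qed.

Lemma differentiable_affine (p q : nat) (c : 'cV[R]_q) (M : 'M[R]_(q, p)) (a : 'cV[R]_p) :
  differentiable (fun v : 'cV[R]_p => c - M *m v) a.
Proof.
by apply: differentiableB; [exact: differentiable_cst|exact: differentiable_mulmxl].
Qed.

Lemma cjacobian_affine (p q : nat) (c : 'cV[R]_q) (M : 'M[R]_(q, p)) (a : 'cV[R]_p) :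
  cjacobian (fun v => c - M *m v) a = - M.
Proof.
rewrite /cjacobian; set f := (fun v : 'rV[R]_p => _).
have fE : f = (fun v => c^T - v *m M^T).
  by apply/funext => v; rewrite /f linearB/= trmx_mul trmxK.
have df : differentiable f a^T.
  rewrite fE; apply: differentiableB; [exact: differentiable_cst|exact: differentiable_mulmxr].
apply/trmx_inj; rewrite trmxK linearN/=.
suff H (v : 'rV[R]_p) : v *m 'J f a^T = v *m (- M^T).
  by rewrite -[LHS]mul1mx -[RHS]mul1mx; apply/row_matrixP => i; rewrite !row_mul H.
rewrite -deriveEjacobian// /derive.
(* the difference quotients of an affine map are constant *)
apply: cvg_lim => //; apply: cvg_near_cst; near=> h.
have h0 : h != 0 by near: h; exact: nbhs_dnbhs_neq.
have -> : (f \o shift a^T) (h *: v) - f a^T = - (h *: (v *m M^T)).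
  rewrite /= fE mulmxDl -scalemxAl opprB addrC addrA subrK.
  by rewrite opprD addrCA subrr addr0.
by rewrite scalerN scalerA mulVf// scale1r mulmxN.
Unshelve. all: by end_near. Qed.

End AffineJacobian.

(** * The inner product of L2 *)

Section InnerProduct.
Context {R : realType} (t0 tf : R) {q : nat}.
Implicit Types u v w : R -> 'cV[R]_q.
Notation mu := (@lebesgue_measure R).
Notation D := `[t0, tf]%classic.

Let mD : measurable (D : set (measurableTypeR R)).
Proof. exact: measurable_itv. Qed.

(** The inner product attached to [L2norm]. *)
Definition L2dot u v : R := \int[mu]_(t in D) (\sum_i u t i 0 * v t i 0).

Lemma L2dot_integrable u v : L2 t0 tf u -> L2 t0 tf v ->
  mu.-integrable D (EFin \o (fun t => \sum_i u t i 0 * v t i 0)).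
Proof.
move=> /L2P lu /L2P lv.
have H := @integrable_sum _ _ _ mu _ mD _ (index_enum 'I_q) xpredT
  (fun i t => (u t i 0 * v t i 0)%:E).
have := H (fun i _ => l2funM (lu i) (lv i)); apply: eq_integrable => // t _ /=.
by rewrite sumEFin.
Qed.

Lemma eq_L2dot u v u' v' : (forall t, D t -> u t = u' t) ->
  (forall t, D t -> v t = v' t) -> L2dot u v = L2dot u' v'.
Proof. by move=> uu vv; apply: eq_Rintegral => t; rewrite inE => Dt; rewrite uu ?vv. Qed.

Lemma L2dot_ge0 u : 0 <= L2dot u u.
Proof. by apply: Rintegral_ge0 => t _; apply: sumr_ge0 => i _; rewrite -expr2 sqr_ge0. Qed.

Lemma L2norm_sqr u : L2norm t0 tf u ^+ 2 = L2dot u u.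
Proof.
rewrite sqr_sqrtr; last by apply: Rintegral_ge0 => t _; rewrite sqr_ge0.
by apply: eq_Rintegral => t _; rewrite enorm_sqr; apply: eq_bigr => i _; rewrite expr2.
Qed.

Lemma L2dot_sqrD u v : L2 t0 tf u -> L2 t0 tf v ->
  L2dot (fun t => u t + v t) (fun t => u t + v t) = L2dot u u + 2 * L2dot u v + L2dot v v.
Proof.
move=> lu lv; have iuu := L2dot_integrable lu lu; have iuv := L2dot_integrable lu lv.
have ivv := L2dot_integrable lv lv.
have i2 : mu.-integrable D (EFin \o (fun t => 2 * (\sum_i u t i 0 * v t i 0))).
  by have := integrableZl mD 2 iuv; apply: eq_integrable.
have i3 : mu.-integrable D (EFin \o
    (fun t => \sum_i u t i 0 * u t i 0 + 2 * (\sum_i u t i 0 * v t i 0))).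
  by have := integrableD mD iuu i2; apply: eq_integrable.
rewrite /L2dot -RintegralZl// -RintegralD// -RintegralD//.
apply: eq_Rintegral => t _; rewrite mulr_sumr -!big_split/=; apply: eq_bigr => i _.
by rewrite !mxE; ring.
Qed.

Lemma L2dot0_ae u : L2 t0 tf u -> L2dot u u = 0 ->
  {ae mu, forall t, D t -> u t = 0}.
Proof.
move=> lu u0; have iuu := L2dot_integrable lu lu.
have f0 t : 0 <= \sum_i u t i 0 * u t i 0.
  by apply: sumr_ge0 => i _; rewrite -expr2 sqr_ge0.
have [h _] := ae_eq_integral_abs mu mD (measurable_int _ iuu).
have {}h : ae_eq mu D (EFin \o (fun t => \sum_i u t i 0 * u t i 0)) (cst 0%E).
  apply: h; rewrite -[RHS](_ : (L2dot u u)%:E = _)/=; last by rewrite u0.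
  rewrite /L2dot /Rintegral fineK; last exact: integrable_fin_num.
  by apply: eq_integral => t _ /=; rewrite ger0_norm.
apply: aeS h => t h Dt; have [/eqP] : (\sum_i u t i 0 * u t i 0)%:E = 0%:E := h Dt.
rewrite psumr_eq0 => [/allP h0|i _]; last by rewrite -expr2 sqr_ge0.
apply/colP => i; rewrite mxE; apply/eqP.
by have := h0 i (mem_index_enum _); rewrite mulf_eq0 orbb.
Qed.

Lemma L2dot_ae0 u v : L2 t0 tf u -> L2 t0 tf v -> L2dot v v = 0 -> L2dot u v = 0.
Proof.
move=> lu lv v0; have iuv := L2dot_integrable lu lv.
rewrite /L2dot /Rintegral (ae_eq_integral (cst 0%E)) ?integral0//.
  exact: measurable_int iuv.
apply: aeS (L2dot0_ae lv v0) => t h Dt /=; congr EFin.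
by rewrite big1// => i _; rewrite h// mxE mulr0.
Qed.

End InnerProduct.

(** * Reachability, Gramian and projection *)

Lemma L2_eq (R : realType) (t0 tf : R) (q : nat) (f g : R -> 'cV[R]_q) :
  (forall t, `[t0, tf]%classic t -> f t = g t) -> L2 t0 tf f -> L2 t0 tf g.
Proof.
move=> fg [mf intf]; split=> [i|].
  apply: eq_measurable_fun (mf i) => t; rewrite inE => Dt.
  by rewrite fg.
apply: le_lt_trans intf; rewrite le_eqVlt; apply/orP; left; apply/eqP.
by apply: eq_integral => t; rewrite inE => Dt; rewrite fg.
Qed.

Section LinearQuadratic.
Context {R : realType} {n m : nat} (t0 tf : R) (A : R -> 'M[R]_n)
  (B : R -> 'M[R]_(n, m)) (X Y : R -> 'M[R]_n).
Notation D := `[t0, tf]%classic.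
Notation mu := (@lebesgue_measure R).
Hypothesis t0tf : t0 <= tf.
Hypothesis bA : forall i j, bmfun t0 tf (fun t => A t i j).
Hypothesis bB : forall i j, bmfun t0 tf (fun t => B t i j).
Hypothesis XY : fundamental_pair t0 tf A X Y.

Let D0 : D t0. Proof. by rewrite /= in_itv/= lexx. Qed.
Let Df : D tf. Proof. by rewrite /= in_itv/= lexx andbT. Qed.

(** The kernel K = Y B of the reachability map. *)
Definition input_kernel (t : R) : 'M[R]_(n, m) := Y t *m B t.

(** The contribution E u of a control to the final state, pulled back to time
    t0 by the inverse of X(tf). *)
Definition reach (u : R -> 'cV[R]_m) : 'cV[R]_n :=
  vint t0 tf (fun t => input_kernel t *m u t).

(** The adjoint of [reach] for the L2 inner product; see
    [L2dot_adjoint_control]. *)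
Definition adjoint_control (lam : 'cV[R]_n) (t : R) : 'cV[R]_m :=
  (input_kernel t)^T *m lam.

(** The controllability Gramian, pulled back to time t0. *)
Definition gramian : 'M[R]_n :=
  \matrix_(i, j) \int[mu]_(t in D) (input_kernel t *m (input_kernel t)^T) i j.

Lemma input_kernel_bm i j : bmfun t0 tf (fun t => input_kernel t i j).
Proof. by apply: bmfun_mulmx => //; have [_] := fundamental_bm XY. Qed.

Lemma adjoint_control_L2 lam : L2 t0 tf (adjoint_control lam).
Proof.
apply: bmfun_L2 => i j; apply: bmfun_mulmx => k l; last exact: bmfun_cst.
by under eq_fun do rewrite mxE; exact: input_kernel_bm.
Qed.

Lemma reach_adjoint_control lam : reach (adjoint_control lam) = gramian *m lam.
Proof.
apply/colP => i; rewrite !mxE.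
rewrite (_ : (fun t => _) = (fun t =>
    \sum_j lam j 0 * (input_kernel t *m (input_kernel t)^T) i j)).
  rewrite Rintegral_lincomb => [|j]; first by apply: eq_bigr => j _; rewrite !mxE mulrC.
  apply/bmfun_integrable/bmfun_mulmx => k l; first exact: input_kernel_bm.
  by under eq_fun do rewrite mxE; exact: input_kernel_bm.
apply/funext => t; rewrite /adjoint_control mulmxA mxE.
by apply: eq_bigr => j _; rewrite mulrC.
Qed.

Lemma L2dot_adjoint_control u lam : L2 t0 tf u ->
  L2dot t0 tf u (adjoint_control lam) = (lam^T *m reach u) 0 0.
Proof.
move=> lu; rewrite mxE.
have lKu := L2_mulmx input_kernel_bm lu.
rewrite (eq_bigr (fun j =>
    lam j 0 * \int[mu]_(t in D) (input_kernel t *m u t) j 0)); last first.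
  by move=> j _; rewrite mxE /reach /vint [X in _ * X]mxE.
rewrite -Rintegral_lincomb => [|j]; last exact: L2_integrable.
apply: eq_Rintegral => t _.
transitivity (((adjoint_control lam t)^T *m u t) 0 0).
  by rewrite [RHS]mxE; apply: eq_bigr => i _; rewrite [X in _ = X * _]mxE mulrC.
rewrite /adjoint_control trmx_mul trmxK -mulmxA mxE.
by apply: eq_bigr => j _; rewrite mxE.
Qed.

Lemma reachB u v : L2 t0 tf u -> L2 t0 tf v ->
  reach (fun t => u t - v t) = reach u - reach v.
Proof.
move=> lu lv; rewrite -vintB; [|exact: L2_mulmx input_kernel_bm _..].
by apply: eq_vint => t _; rewrite mulmxBr.
Qed.

Lemma response_final x0 u : L2 t0 tf u ->
  response t0 tf X Y x0 (fun t => B t *m u t) tf = X tf *m (x0 + reach u).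
Proof.
move=> lu; rewrite /response vprimitive_end//; congr (_ *m (_ + _)).
by apply: eq_vint => t _; rewrite mulmxA.
Qed.

Lemma constraint_setE x0 xf u : constraint_set t0 tf A B x0 xf u <->
  L2 t0 tf u /\ X tf *m (x0 + reach u) = xf.
Proof.
split=> [[lu [x [xsol xt0 xtf]]]|[lu xtf]].
  split=> //; rewrite -response_final// -xt0 -xtf; apply/esym.
  by apply: solves_response xsol _ => //; exact: L2_mulmx.
split=> //; exists (response t0 tf X Y x0 (fun t => B t *m u t)); split.
- by apply: response_solves => //; exact: L2_mulmx.
- exact: response_left XY _ _.
- by rewrite response_final.
Qed.

Lemma shifted_controlE um lam t : D t ->
  shifted_control t0 tf A B um lam t = um t - adjoint_control lam t.
Proof.
move=> Dt; have [X0 _ _ _ _] := XY; rewrite /shifted_control.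
rewrite (transition_matrixE bA XY Dt D0) X0 mul1mx.
by rewrite /adjoint_control /input_kernel trmx_mul.
Qed.

Lemma shifted_control_L2 um lam : L2 t0 tf um ->
  L2 t0 tf (shifted_control t0 tf A B um lam).
Proof.
move=> lum; apply: L2_eq (L2B lum (adjoint_control_L2 lam)) => t Dt.
by rewrite shifted_controlE.
Qed.

Lemma reach_shifted_control um lam : L2 t0 tf um ->
  reach (shifted_control t0 tf A B um lam) = reach um - gramian *m lam.
Proof.
move=> lum.
rewrite -reach_adjoint_control -(reachB lum (adjoint_control_L2 lam)).
by apply: eq_vint => t Dt; rewrite shifted_controlE.
Qed.

Lemma zsol_final x0 um lam : L2 t0 tf um ->
  zsol t0 tf A B x0 um lam tf =
  X tf *m (x0 + reach um) - (X tf *m gramian) *m lam.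
Proof.
move=> lum; pose u := shifted_control t0 tf A B um lam.
have lu : L2 t0 tf u by exact: shifted_control_L2.
have lBu : L2 t0 tf (fun t => B t *m u t) by exact: L2_mulmx.
pose S := [set z : R -> 'cV[R]_n | solves_ode t0 tf A (fun t => B t *m u t) z /\ z t0 = x0].
have [zS z0] : S (zsol t0 tf A B x0 um lam).
  apply: xgetPex; exists (response t0 tf X Y x0 (fun t => B t *m u t)).
  by split; [exact: response_solves|exact: response_left XY _ _].
rewrite (solves_response XY lBu zS Df) z0 response_final// reach_shifted_control//.
by rewrite addrA mulmxBr mulmxA.
Qed.

Lemma final_state_formula x0 um : L2 t0 tf um ->
  transition_matrix t0 tf A tf t0 *m x0 +
    vint t0 tf (fun tau => transition_matrix t0 tf A tf tau *m B tau *m um tau) =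
  X tf *m (x0 + reach um).
Proof.
move=> lum; have [_ Y0 _ _ _] := XY.
rewrite (transition_matrixE bA XY D0 Df) Y0 mulmx1 mulmxDr; congr (_ + _).
rewrite -vint_mulmx; last exact: L2_mulmx input_kernel_bm _.
by apply: eq_vint => t Dt; rewrite (transition_matrixE bA XY Dt Df) !mulmxA.
Qed.

(** If W v = 0, then the adjoint control of v vanishes almost everywhere, and
    pairing it with a control that reaches v shows that v = 0. *)
Lemma gramian_unit : controllable t0 tf A B -> gramian \in unitmx.
Proof.
move=> ctrl; rewrite -unitmx_tr -row_free_unit; apply: inj_row_free => w wG.
pose v := w^T; have Gv : gramian *m v = 0.
  by apply: trmx_inj; rewrite trmx_mul trmxK wG trmx0.
have lG := adjoint_control_L2 v.
have GG0 : L2dot t0 tf (adjoint_control v) (adjoint_control v) = 0.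
  by rewrite L2dot_adjoint_control// reach_adjoint_control Gv mulmx0 mxE.
have [u /constraint_setE[lu]] := ctrl 0 (X tf *m v).
rewrite add0r => Xu; have uv : reach u = v.
  have [_ _ _ _ iXY] := XY; have [YX _] := iXY tf Df.
  by rewrite -[LHS]mul1mx -[RHS]mul1mx -YX -!mulmxA Xu.
have := L2dot_adjoint_control v lu; rewrite (L2dot_ae0 lu lG GG0) uv mxE => /esym/eqP.
rewrite psumr_eq0 => [/allP h0|i _]; last by rewrite mxE -expr2 sqr_ge0.
apply/rowP => i; rewrite mxE; apply/eqP.
by have := h0 i (mem_index_enum _); rewrite !mxE mulf_eq0 orbb.
Qed.

(** Two admissible controls differ by an element orthogonal to every adjoint
    control, and p - um is minus an adjoint control. *)
Lemma cost_pythagoras x0 xf um lam u :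
  L2 t0 tf um -> constraint_set t0 tf A B x0 xf u ->
  let p := shifted_control t0 tf A B um lam in
  constraint_set t0 tf A B x0 xf p ->
  L2norm t0 tf (fun t => u t - um t) ^+ 2 =
  L2norm t0 tf (fun t => p t - um t) ^+ 2 + L2norm t0 tf (fun t => u t - p t) ^+ 2.
Proof.
move=> lum /constraint_setE[lu ru] p /constraint_setE[lp rp].
rewrite [LHS]L2norm_sqr [X in _ = X + _]L2norm_sqr [X in _ = _ + X]L2norm_sqr.
have lup := L2B lu lp; have lpm := L2B lp lum.
have -> : (fun t => u t - um t) = (fun t => (u t - p t) + (p t - um t)).
  by apply/funext => t; rewrite addrA subrK.
rewrite (L2dot_sqrD lup lpm).
have -> : L2dot t0 tf (fun t => u t - p t) (fun t => p t - um t) =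
    L2dot t0 tf (fun t => u t - p t) (adjoint_control (- lam)).
  apply: eq_L2dot => // t Dt; rewrite /p shifted_controlE// addrC addKr.
  by rewrite /adjoint_control mulmxN.
rewrite (L2dot_adjoint_control _ lup) (reachB lu lp).
have -> : reach u = reach p.
  have [_ _ _ _ iXY] := XY; have [YX _] := iXY tf Df.
  apply: (addrI x0); rewrite -[LHS]mul1mx -[RHS]mul1mx -YX -!mulmxA.
  by rewrite ru rp.
by rewrite subrr mulmx0 mxE mulr0 addr0 addrC.
Qed.

Lemma shifted_control_projection x0 xf um lam : L2 t0 tf um ->
  X tf *m (x0 + reach um) - (X tf *m gramian) *m lam = xf ->
  is_projection t0 tf (constraint_set t0 tf A B x0 xf) um
    (shifted_control t0 tf A B um lam).
Proof.
move=> lum hlam; set p := shifted_control _ _ _ _ _ _.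
have lp : L2 t0 tf p by exact: shifted_control_L2.
have Cp : constraint_set t0 tf A B x0 xf p.
  apply/constraint_setE; split=> //.
  by rewrite reach_shifted_control// addrA mulmxBr mulmxA.
split.
  split; first exact: Cp.
  move=> u Cu; rewrite (cost_pythagoras lum Cu Cp) ler_pM2l ?invr_gt0 ?ltr0n//.
  by rewrite lerDl sqr_ge0.
move=> v [Cv /(_ _ Cp)].
rewrite (cost_pythagoras lum Cv Cp) ler_pM2l ?invr_gt0 ?ltr0n//.
rewrite gerDl L2norm_sqr => vp0.
have [lv _] := (constraint_setE _ _ _).1 Cv.
have vp : L2dot t0 tf (fun t => v t - p t) (fun t => v t - p t) = 0.
  by apply/eqP; rewrite eq_le vp0 L2dot_ge0.
apply: aeS (L2dot0_ae (L2B lv lp) vp) => t h Dt.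
by apply/eqP; rewrite -subr_eq0 h.
Qed.

End LinearQuadratic.

Unset Implicit Arguments.
Set Strict Implicit.
Set Printing Implicit Defensive.

Theorem theorem1 (R : realType) (n m : nat) (t0 tf : R) (x0 xf : 'cV[R]_n)
    (A : R -> 'M[R]_n) (B : R -> 'M[R]_(n, m)) (um : R -> 'cV[R]_m) :
  t0 < tf ->
  {within `[t0, tf], continuous A} ->
  {within `[t0, tf], continuous B} ->
  controllable t0 tf A B ->
  L2 t0 tf um ->
  let Phi := transition_matrix t0 tf A in
  let z := zsol t0 tf A B x0 um in
  let phi := near_miss t0 tf A B x0 xf um in
  let y_tf := Phi tf t0 *m x0
              + vint t0 tf (fun tau => Phi tf tau *m B tau *m um tau) in
  let dy_tf := cjacobian (fun lam => z lam tf) 0 in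
  [/\ z 0 tf = y_tf,
      exists lam : 'cV[R]_n, dy_tf *m lam = - (y_tf - xf),
      forall lam : 'cV[R]_n, dy_tf *m lam = - (y_tf - xf) ->
        is_projection t0 tf (constraint_set t0 tf A B x0 xf) um
          (fun t => um t - (B t)^T *m (Phi t0 t)^T *m lam),
      differentiable (fun lam => z lam tf) 0 /\ differentiable phi 0
    & dy_tf = cjacobian phi 0].
Proof.
move=> t0tf cA cB ctrl lum Phi z phi y_tf dy_tf.
have le_t0tf := ltW t0tf.
have bA := continuous_mx_bmfun cA; have bB := continuous_mx_bmfun cB.
have [X [Y XY]] := fundamental_pair_exists le_t0tf bA.
have Df : `[t0, tf]%classic tf by rewrite /= in_itv/= le_t0tf lexx.
have [YX XYf] : Y tf *m X tf = 1%:M /\ X tf *m Y tf = 1%:M.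
  by have [_ _ _ _ iXY] := XY; exact: iXY.
have yE : y_tf = X tf *m (x0 + reach t0 tf B Y um).
  exact: final_state_formula.
(* the final state is affine in lambda *)
have zE : (fun lam => z lam tf) =
    (fun lam => y_tf - (X tf *m gramian t0 tf B Y) *m lam).
  by apply/funext => lam; rewrite yE; exact: zsol_final.
have phiE : phi = (fun lam => (y_tf - xf) - (X tf *m gramian t0 tf B Y) *m lam).
  apply/funext => lam; rewrite /phi /near_miss -/z.
  by rewrite [z lam tf](congr1 (@^~ lam) zE) addrAC.
have dyE : dy_tf = - (X tf *m gramian t0 tf B Y).
  by rewrite /dy_tf zE cjacobian_affine.
split.
- by rewrite [z 0 tf](congr1 (@^~ 0) zE) mulmx0 subr0.
- have Wu := gramian_unit le_t0tf bA bB XY ctrl.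
  (* the solution is W^-1 Y(tf) (y_tf - xf) *)
  exists (invmx (gramian t0 tf B Y) *m (Y tf *m (y_tf - xf))).
  rewrite dyE mulNmx mulmxA -(mulmxA (X tf)) mulmxV// mulmx1.
  by rewrite mulmxA XYf mul1mx.
- move=> lam; rewrite dyE mulNmx => /oppr_inj hlam.
  apply: (shifted_control_projection le_t0tf bA bB XY lum).
  by rewrite hlam -yE opprB addrC subrK.
- by rewrite zE phiE; split; exact: differentiable_affine.
- by rewrite dyE phiE cjacobian_affine.
Qed.
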